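(* Let $a\in(-1,1)$ and let $H$ be the operator in $L^2((-\frac{\pi}{2},\frac{\pi}{2}))$ defined by $H\psi=-\psi''$ on the domain $\mathsf{D}(H)=\{\psi\in H^2((-\frac{\pi}{2},\frac{\pi}{2})) : \psi(-\frac{\pi}{2})=\psi(\frac{\pi}{2}a)=\psi(\frac{\pi}{2})\}$. All the eigenvalues of $H$ are algebraically simple if, and only if, $a\notin\mathbb{Q}$.
   Context: $L^2((-\frac{\pi}{2},\frac{\pi}{2}))$ is the complex Hilbert space of square-integrable functions and $H^2$ denotes the usual Sobolev space, whose elements are identified with their continuous representatives on $[-\frac{\pi}{2},\frac{\pi}{2}]$. The algebraic multiplicity of an eigenvalue $\lambda$ of $H$ is $\dim\bigcup_{n\ge1}\ker (H-\lambda)^n$; $\lambda$ is algebraically simple if this dimension equals one. *)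

(* Defs.v *)
From HB Require Import structures.
From mathcomp Require Import all_boot all_order all_algebra.
From mathcomp Require Import complex ring_quotient generic_quotient.
From mathcomp Require Import ring.
From mathcomp Require Import all_classical all_reals all_analysis.
From mathcomp Require Import measurable_realfun.

Set Implicit Arguments.
Unset Strict Implicit.
Unset Printing Implicit Defensive.
Import Order.TTheory GRing.Theory Num.Theory.
Import numFieldNormedType.Exports.

Local Open Scope classical_set_scope.
Local Open Scope ring_scope.

Section Operators.
Context {K : fieldType} {X : lmodType K}.

(* A partially defined operator; the values of [op_app] outside [op_dom] are
   irrelevant. *)
Record operator := Operator { op_dom : set X; op_app :> X -> X }.

Definition op_ker (T : operator) : set X := [set x | op_dom T x /\ T x = 0].

Definition op_shift (T : operator) (lambda : K) : operator :=
  Operator (op_dom T) (fun x => T x - lambda *: x).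

Fixpoint op_pow (T : operator) (n : nat) : operator :=
  if n is m.+1 then
    Operator [set x | op_dom T x /\ op_dom (op_pow T m) (T x)]
             (fun x => op_pow T m (T x))
  else Operator setT id.

Definition op_eigenvalue (T : operator) (lambda : K) : Prop :=
  exists x : X, x != 0 /\ op_ker (op_shift T lambda) x.

Definition root_space (T : operator) (lambda : K) : set X :=
  \bigcup_(n in [set n | (1 <= n)%N]) op_ker (op_pow (op_shift T lambda) n).

Definition has_dim (V : set X) (d : nat) : Prop :=
  exists b : 'I_d -> X,
    (forall c : 'I_d -> K, \sum_i c i *: b i = 0 -> forall i, c i = 0) /\
    V = [set x | exists c : 'I_d -> K, x = \sum_i c i *: b i].

Definition has_alg_multiplicity (T : operator) (lambda : K) (m : nat) : Prop :=
  has_dim (root_space T lambda) m.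

Definition alg_simple (T : operator) (lambda : K) : Prop :=
  has_alg_multiplicity T lambda 1.

End Operators.
Arguments operator {K} X.

Definition Iopen (R : realType) : set R := `](- (pi / 2)), (pi / 2)[.
Definition Iclosed (R : realType) : set R := `[(- (pi / 2)), (pi / 2)].
Arguments Iopen R : clear implicits.
Arguments Iclosed R : clear implicits.

Section L2.
Context {R : realType}.
Local Notation mu := (@lebesgue_measure R).
Local Notation I := (Iopen R).

(* [R[i]^o] is [R[i]] as a vector space over itself.  Functions are total on
   [R], but only their restriction to [I] matters.  Measurability, integrals
   and continuity of complex functions are taken componentwise. *)
Implicit Types f g : R -> R[i]^o.

Definition cmeasurable f : Prop :=
  measurable_fun I (fun x => complex.Re (f x)) /\ measurable_fun I (fun x => complex.Im (f x)).

Definition square_integrable f : Prop :=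
  cmeasurable f /\ (\int[mu]_(x in I) (Normc.normc (f x) ^+ 2)%:E < +oo)%E.

Definition sqint_pred : {pred R -> R[i]^o} := mem [set f | square_integrable f].

Let normc2 (z : R[i]) : Normc.normc z ^+ 2 = complex.Re z ^+ 2 + complex.Im z ^+ 2.
Proof. by case: z => x y /=; rewrite sqr_sqrtr// addr_ge0 ?sqr_ge0. Qed.

Let measI : measurable I. Proof. exact: measurable_itv. Qed.

Let meas_normc2 f : cmeasurable f ->
  measurable_fun I (fun x => (Normc.normc (f x) ^+ 2)%:E : \bar R).
Proof.
move=> [mr mi]; apply/measurable_EFinP.
under eq_fun do rewrite normc2.
by apply: measurable_funD; apply: measurable_funX.
Qed.

Lemma sqint_submod_closed : submod_closed sqint_pred.
Proof.
split.
  rewrite inE; split; first by split => //=; exact: measurable_cst.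
  under eq_integral do rewrite normc2/= expr0n/= addr0.
  by rewrite integral0.
move=> a f g; rewrite !inE => -[mf lf] [mg lg].
case: (mf) (mg) => mfr mfi [mgr mgi].
have mh : cmeasurable (a *: f + g).
  split.
    rewrite (_ : (fun x => _) = (fun x => (complex.Re a * complex.Re (f x) - complex.Im a * complex.Im (f x))
      + complex.Re (g x))); last first.
      by apply/funext => x /=; rewrite [_ x]/(a * f x + g x);
         case: a (f x) (g x) => [? ?] [? ?] [? ?].
    apply: measurable_funD => //; apply: measurable_funB;
      by apply: measurable_funM => //; exact: measurable_cst.
  rewrite (_ : (fun x => _) = (fun x => (complex.Re a * complex.Im (f x) + complex.Im a * complex.Re (f x))
      + complex.Im (g x))); last first.
    by apply/funext => x /=; rewrite [_ x]/(a * f x + g x);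
       case: a (f x) (g x) => [? ?] [? ?] [? ?].
  apply: measurable_funD => //; apply: measurable_funD;
    by apply: measurable_funM => //; exact: measurable_cst.
split=> //.
pose A := 2 * Normc.normc a ^+ 2.
have A0 : 0 <= A by rewrite mulr_ge0// sqr_ge0.
apply: (@le_lt_trans _ _ (\int[mu]_(x in I)
   (A%:E * (Normc.normc (f x) ^+ 2)%:E
   + 2%:E * (Normc.normc (g x) ^+ 2)%:E))%E).
  apply: ge0_le_integral => //.
  - by move=> x _; rewrite lee_fin sqr_ge0.
  - exact: meas_normc2.
  - by apply: emeasurable_funD; apply: emeasurable_funM => //;
      exact: meas_normc2.
  - move=> x _; rewrite -!EFinM -EFinD lee_fin.
    rewrite [(a *: f + g) x]/(a * f x + g x) /A.
    rewrite -mulrA -exprMn -Normc.normcM -mulrDr.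
    move: (a * f x) => {}z; rewrite !normc2.
    case: z (g x) => [p q] [r s] /=.
    rewrite -subr_ge0 (_ : _ - _ = (p - r) ^+ 2 + (q - s) ^+ 2).
      by rewrite addr_ge0 ?sqr_ge0.
    by rewrite !(sqrrD, sqrrB) !mulr2n !mulrDl !mul1r;
      rewrite -!mulr2n; ring.
rewrite ge0_integralD//; first last.
- by apply: emeasurable_funM => //; exact: meas_normc2.
- by move=> x _; rewrite -EFinM lee_fin mulr_ge0// sqr_ge0.
- by apply: emeasurable_funM => //; exact: meas_normc2.
- by move=> x _; rewrite -EFinM lee_fin mulr_ge0// sqr_ge0.
by rewrite !ge0_integralZl_EFin ?lte_add_pinfty ?lte_mul_pinfty//;
  first [ exact: meas_normc2 | move=> x _; rewrite lee_fin sqr_ge0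
        | apply: integral_ge0 => x _; rewrite lee_fin sqr_ge0 ].
Qed.

HB.instance Definition _ :=
  GRing.isSubmodClosed.Build _ _ sqint_pred sqint_submod_closed.

Record sqint := SqInt {
  sqint_val :> R -> R[i]^o ; _ : sqint_val \in sqint_pred }.

HB.instance Definition _ := [isSub for sqint_val].
HB.instance Definition _ := [Choice of sqint by <:].
HB.instance Definition _ := [SubChoice_isSubLmodule of sqint by <:].

Lemma sqintBE (f g : sqint) x : (f - g) x = f x - g x. Proof. by []. Qed.

Lemma sqintZE (c : R[i]) (f : sqint) x : (c *: f) x = c * f x.
Proof. by []. Qed.

#[global] Instance ae_lebesgue_filter : Filter (nbhs (almost_everywhere mu)).
Proof. exact: ae_filter_ringOfSetsType. Qed.

Definition ae_null : {pred sqint} :=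
  mem [set f : sqint | \forall x \ae mu, I x -> f x = 0].

Lemma ae_null_zmod_closed : zmod_closed ae_null.
Proof.
split; first by rewrite inE; apply/aeW => x _.
move=> f g; rewrite !inE => f0 g0.
apply: filterS2 f0 g0 => x f0 g0 Ix.
by rewrite sqintBE (f0 Ix) (g0 Ix) subr0.
Qed.

HB.instance Definition _ :=
  GRing.isZmodClosed.Build _ ae_null ae_null_zmod_closed.

(* The complex Hilbert space, as a vector space: square-integrable functions
   modulo equality almost everywhere on [I]. *)
Definition L2 : Type := Quotient.quot ae_null.
HB.instance Definition _ := GRing.Zmodule.on L2.
HB.instance Definition _ := EqQuotient.on L2.

Local Open Scope quotient_scope.

Definition L2_scale (c : R[i]) (u : L2) : L2 := \pi_L2 (c *: repr u).

Lemma L2_eqP (f g : sqint) :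
  \pi_L2 f = \pi_L2 g <->
  \forall x \ae mu, I x -> f x = g x.
Proof.
have -> : (\pi_L2 f = \pi_L2 g) <-> f - g \in ae_null.
  by split => [/eqP|fg]; [rewrite -Quotient.idealrBE|
    apply/eqP; rewrite -Quotient.idealrBE].
rewrite inE; split; apply: filterS => x fg Ix; have := fg Ix.
  by rewrite sqintBE => /eqP; rewrite subr_eq0 => /eqP.
by move=> fgx; rewrite sqintBE fgx subrr.
Qed.

Lemma L2_reprE (f : sqint) :
  \forall x \ae mu, I x -> repr (\pi_L2 f) x = f x.
Proof. by apply/L2_eqP; rewrite reprK. Qed.

Lemma pi_L2Z c (f : sqint) : L2_scale c (\pi_L2 f) = \pi_L2 (c *: f).
Proof.
apply/L2_eqP; apply: filterS (L2_reprE f) => x fx Ix.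
by rewrite !sqintZE (fx Ix).
Qed.

Lemma pi_L2D (f g : sqint) : \pi_L2 f + \pi_L2 g = \pi_L2 (f + g).
Proof. by apply: esym; exact: (Quotient.pi_add ae_null f g). Qed.

Fact L2_scaleA a b u : L2_scale a (L2_scale b u) = L2_scale (a * b) u.
Proof.
rewrite -[u]reprK; move: (repr u) => f.
by rewrite (pi_L2Z b f) (pi_L2Z a) (pi_L2Z (a * b)) scalerA.
Qed.

Fact L2_scale1 : left_id 1 L2_scale.
Proof. by move=> u; rewrite -[u]reprK pi_L2Z scale1r. Qed.

Fact L2_scaleDr : right_distributive L2_scale +%R.
Proof.
move=> a u v; rewrite -[u]reprK -[v]reprK; move: (repr u) (repr v) => f g.
by rewrite pi_L2D !pi_L2Z pi_L2D scalerDr.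
Qed.

Fact L2_scaleDl u : {morph L2_scale^~ u : a b / a + b}.
Proof.
move=> a b; rewrite -[u]reprK; move: (repr u) => f.
by rewrite !pi_L2Z pi_L2D scalerDl.
Qed.

HB.instance Definition _ := GRing.Zmodule_isLmodule.Build R[i] L2
  L2_scaleA L2_scale1 L2_scaleDr L2_scaleDl.

Definition L2_fun (u : L2) : R -> R[i]^o := repr u.

End L2.
Arguments L2 R : clear implicits.
Coercion L2_fun : L2 >-> Funclass.

Section Sobolev.
Context {R : realType}.
Local Notation mu := (@lebesgue_measure R).
Local Notation I := (Iopen R).

Definition cintegral (f : R -> R[i]) : R[i] :=
  Complex (\int[mu]_(x in I) complex.Re (f x))
          (\int[mu]_(x in I) complex.Im (f x)).

(* Smooth functions with compact support in [I]; testing with real-valued ones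
   is enough, since both sides below are complex-linear in the test function. *)
Definition test_function (phi : R -> R) : Prop :=
  [/\ forall n x, derivable (derive1n n phi) x 1,
      compact (closure [set x | phi x != 0]) &
      closure [set x | phi x != 0] `<=` I].

Definition is_weak_derivative (u v : L2 R) : Prop :=
  forall phi, test_function phi ->
    cintegral (fun x => u x * (derive1 phi x)%:C%C) =
    - cintegral (fun x => v x * (phi x)%:C%C).

Definition weakly_derivable (u : L2 R) : Prop :=
  exists v, is_weak_derivative u v.

(* The weak derivative is unique as an element of [L2]; the value is [0] when
   there is none. *)
Definition wderiv (u : L2 R) : L2 R := xget 0 [set v | is_weak_derivative u v].

Definition H1 : set (L2 R) := [set u | weakly_derivable u].
Definition H2 : set (L2 R) := [set u | H1 u /\ H1 (wderiv u)].

Definition continuous_rep (u : L2 R) (w : R -> R[i]) : Prop :=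
  [/\ {within Iclosed R, continuous (fun x => complex.Re (w x))},
      {within Iclosed R, continuous (fun x => complex.Im (w x))} &
      \forall x \ae mu, I x -> u x = w x].

(* [w] runs over the continuous representatives of [u] on the closed interval;
   its values there are determined by [u]. *)
Definition Hop (a : R) : operator (L2 R) :=
  Operator
    [set u | H2 u /\ exists w, [/\ continuous_rep u w,
       w (- (pi / 2)) = w (pi / 2 * a) & w (pi / 2 * a) = w (pi / 2)]]
    (fun u => - wderiv (wderiv u)).

End Sobolev.

(* Main.v *)
(* Write L = pi/2.  By elliptic regularity in one dimension, a function u in the
   domain with (H - k^2) u = f, f an explicit smooth function, is a classical
   solution of -u'' = k^2 u + f: comparing the weak derivative relation on test
   functions that approximate the indicator of ]c, d], for Lebesgue points c < d
   of u, gives u d - u c = \int_c^d u'.  The eigenvalue 0 has polynomial solutions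
   and is checked directly.  For k != 0 the solutions are P e^{ikx} + Q e^{-ikx},
   plus a term x (-P0 e^{ikx} + Q0 e^{-ikx}) / (2ik) when
   f = P0 e^{ikx} + Q0 e^{-ikx}.  With e = e^{ikL} and g = e^{ikLa}, the boundary
   conditions are linear in (P, Q).  They force dim ker (H - k^2) <= 1 and
   ker (H - k^2)^2 = ker (H - k^2), unless e^2 = 1 and g = e; in that case kL
   (nonzero) and kLa are integer multiples of pi, so a is rational.
   Conversely, if a = n/d then for k = 4d both e^{ikx} and e^{-ikx} take the value
   1 at -L, La and L, hence are eigenfunctions for the same eigenvalue. *)
Require Import Defs.
From mathcomp Require Import all_boot all_order all_algebra.
From mathcomp Require Import complex generic_quotient.
From mathcomp Require Import all_classical all_reals all_analysis.
From mathcomp Require Import ring lra.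
From mathcomp Require Import measurable_realfun.
Set Implicit Arguments.
Unset Strict Implicit.
Unset Printing Implicit Defensive.
Import Order.TTheory GRing.Theory Num.Theory.
Import numFieldNormedType.Exports.
Local Open Scope classical_set_scope.
Local Open Scope ring_scope.

(** * A smooth step function *)

(** [H] is not symmetric, so neither real eigenvalues nor equality of geometric and algebraic
    multiplicity can be assumed: [k] ranges over all nonzero complex numbers, and it becomes real
    only when e^2 = 1 forces |e| = 1. Stabilisation at the second power is enough, since ker S^2 =
    ker S propagates to every power of S. The obstacle in the regularity step is that elements of
    [L2] are known up to null sets, while the boundary conditions are pointwise, one of them at an
    interior point. Continuous representatives are therefore built from mere integrability, and
    classical derivatives follow once the equation shows that u'' has a continuous representative
    too. Test functions must be smooth with compact support, hence the construction from exp(-1/x).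
    The analysis is done on real functions; complex statements are pairs of real ones. *)

Section SmoothFunctions.
Context {R : realType}.
Implicit Types (f g : R -> R) (p : {poly R}).

(* [Cdiff n f]: [f] is differentiable [n + 1] times. *)
Fixpoint Cdiff (n : nat) f : Prop :=
  if n is m.+1 then exists2 g : R -> R, (forall x : R, is_derive x 1 f (g x)) & Cdiff m g
  else forall x : R, derivable f x 1.

Lemma CdiffW n f : Cdiff n.+1 f -> Cdiff n f.
Proof.
elim: n f => [|n IH] f [g fg Cg]; first by move=> x; exact: ex_derive.
by exists g => //; exact: IH.
Qed.

Lemma Cdiff_derive1n n f : Cdiff n f -> forall x, derivable (derive1n n f) x 1.
Proof.
elim: n f => [|n IH] f => [|[g fg Cg]] x; first exact.
have -> : derive1n n.+1 f = derive1n n g.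
  rewrite /derive1n iterSr; congr (iter n _ _); apply/funext => y.
  by rewrite derive1E; exact: derive_val.
exact: IH.
Qed.

Lemma Cdiff_cst n (c : R) : Cdiff n (fun=> c).
Proof.
elim: n c => [|n IH] c /=; first by move=> x; exact: derivable_cst.
by exists (fun=> 0) => // x; exact: is_derive_cst.
Qed.

Lemma CdiffD n f g : Cdiff n f -> Cdiff n g -> Cdiff n (f \+ g).
Proof.
elim: n f g => [|n IH] f g /=.
  by move=> Hf Hg x; exact: derivableD.
move=> [f' Hf Cf] [g' Hg Cg]; exists (f' \+ g'); last exact: IH.
by move=> x; exact: is_deriveD.
Qed.

Lemma CdiffM n f g : Cdiff n f -> Cdiff n g -> Cdiff n (f \* g).
Proof.
elim: n f g => [|n IH] f g.
  by move=> Hf Hg x; exact: derivableM.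
move=> Cf0 Cg0; have Cf1 := CdiffW Cf0; have Cg1 := CdiffW Cg0.
case: Cf0 Cg0 => [f' Hf Cf] [g' Hg Cg].
exists ((f \* g') \+ (g \* f')); last by apply: CdiffD; exact: IH.
by move=> x; exact: is_deriveM.
Qed.

(** The derivative of 1/f is -f' (1/f)^2, so only 1/f at one order less is required, which the
    induction supplies. *)
Lemma CdiffV n f : (forall x, f x != 0) -> Cdiff n f ->
  Cdiff n (fun x => (f x)^-1).
Proof.
move=> f0; elim: n => [|n IH].
  by move=> Hf x; exact: derivableV.
move=> Cf0; have Cf1 := CdiffW Cf0; case: Cf0 => [f' Hf Cf].
have Cg := IH Cf1.
exists (((fun=> -1) \* f') \* ((fun x => (f x)^-1) \* (fun x => (f x)^-1))).
  move=> x; apply: DeriveDef; first (have [? _] := Hf x; exact: derivableV).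
  rewrite deriveV//.
  by rewrite derive_val /= -exprVn /GRing.scale /=; ring.
apply: CdiffM; last exact: CdiffM.
by apply: CdiffM => //; exact: Cdiff_cst.
Qed.

Lemma Cdiff_affine n f (c d : R) : Cdiff n f -> Cdiff n (fun x => f (c * x + d)).
Proof.
have der (x : R) : is_derive x 1 (fun x => c * x + d) c.
  have dd := is_deriveD (is_deriveM (is_derive_cst c x 1) (is_derive_id x 1)) (is_derive_cst d x 1).
  by apply: (is_derive_eq dd); rewrite /GRing.scale /=; ring.
elim: n f => [|n IH] f.
  move=> Cf x; have Hf := derivableP (Cf (c * x + d)).
  have := @is_derive1_comp _ f (fun x => c * x + d) x _ _ Hf (der x).
  by move=> H; exact: ex_derive.
move=> [f' Hf Cf]; exists ((fun=> c) \* (fun x => f' (c * x + d))).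
  move=> x.
  have := @is_derive1_comp _ f (fun x => c * x + d) x _ _ (Hf (c * x + d)) (der x).
  by rewrite /= mulrC.
by apply: CdiffM; [exact: Cdiff_cst|exact: IH].
Qed.

(* The class of all [p(1/x) exp(-1/x)], extended by [0] to [x <= 0], is stable under
   differentiation; [flat 1] is the usual smooth flat function. *)
Definition flat p (x : R) : R :=
  if 0 < x then p.[x^-1] * expR (- x^-1) else 0.

(** Monomial by monomial: y^i / i! is a single term of the exponential series. *)
Lemma poly_le_expR p : exists C : R, forall y, 0 <= y -> `|p.[y]| <= C * expR y.
Proof.
exists (\sum_(i < size p) `|p`_i| * i`!%:R) => y y0.
rewrite horner_coef; apply: le_trans (ler_norm_sum _ _ _) _.
rewrite mulr_suml; apply: ler_sum => i _.
rewrite normrM -mulrA ler_wpM2l// ger0_norm ?exprn_ge0//.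
rewrite -ler_pdivrMl ?ltr0n ?fact_gt0// mulrC.
case: (nat_of_ord i) => [|m].
  by rewrite expr0 fact0 invr1 mulr1 -expR0 ler_expR.
by apply: le_trans (expR_ge1Dxn m y0); rewrite lerDr.
Qed.

(** The difference quotient at 0 is at most C |h|. This handles the point where the two branches of
    [flat] meet. *)
Lemma is_derive0_sqr f (C : R) : f 0 = 0 -> (forall x, `|f x| <= C * x ^+ 2) ->
  is_derive (0 : R) 1 f 0.
Proof.
move=> f0 fC.
have C0 : 0 <= C by have := fC 1; rewrite expr1n mulr1; apply: le_trans.
have H : (fun h : R => h^-1 *: ((f \o shift 0) (h *: 1) - f 0)) @ 0^' --> (0 : R).
  apply/cvgr0Pnorm_le => e e0; near=> h.
  rewrite /= f0 subr0 addr0 /GRing.scale /= mulr1 normrM normfV.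
  have h0 : 0 < `|h| by rewrite normr_gt0; near: h; exact: nbhs_dnbhs_neq.
  rewrite ler_pdivrMl//; apply: le_trans (fC h) _.
  rewrite -real_normK ?num_real// expr2 mulrCA ler_wpM2l ?(ltW h0)//.
  have h1 : `|h| <= e / (C + 1).
    near: h; apply: dnbhs0_le; rewrite divr_gt0// ltr_wpDl//.
  apply: (@le_trans _ _ ((C + 1) * `|h|)); first by rewrite ler_wpM2r// lerDl.
  by rewrite -ler_pdivlMl ?ltr_wpDl// mulrC.
by apply: DeriveDef; [apply/cvg_ex; exists 0|apply: cvg_lim].
Unshelve. all: by end_near. Qed.

(** For x > 0 the chain rule on p(1/x) exp(-1/x) produces the factor x^-2 and the polynomial p - p',
    whence the new polynomial. At 0, bounding X^2 p by the exponential gives |flat p x| <= C x^2. *)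
Lemma is_derive_flat p (x : R) :
  is_derive x 1 (flat p) (flat ('X^2 * (p - p^`())%R) x).
Proof.
have [x0|x0|->] := ltgtP x 0.
- rewrite {2}/flat ltNge (ltW x0)/=.
  apply: (@near_eq_is_derive _ _ _ (fun=> 0)).
  near=> y; rewrite /flat ltNge; have -> // : y <= 0.
  by apply: ltW; near: y; exact: lt_nbhsl.
- rewrite {2}/flat x0.
  apply: (@near_eq_is_derive _ _ _ (fun x : R => p.[x^-1] * expR (- x^-1))).
    near=> y; rewrite /flat; have -> // : 0 < y.
    by near: y; exact: lt_nbhsr.
  have di : is_derive x 1 (fun y : R => y^-1) (- x ^- 2).
    apply: DeriveDef; first by apply: derivableV; rewrite ?gt_eqF.
    by rewrite deriveV ?gt_eqF// derive_id /GRing.scale /= mulr1.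
  have dp := @is_derive1_comp _ (horner p) (fun y => y^-1) x _ _ (is_derive_poly p _) di.
  have de := @is_derive1_comp _ expR (fun y => - y^-1) x _ _ (is_derive_expR _) (is_deriveN di).
  apply: (is_derive_eq (is_deriveM dp de)).
  rewrite /= !hornerE /GRing.scale /=.
  by rewrite -!exprVn; ring.
- rewrite {2}/flat ltxx.
  have [C HC] := poly_le_expR ('X^2 * p).
  apply: (@is_derive0_sqr _ C); first by rewrite /flat ltxx.
  move=> y; rewrite /flat; case: ifPn => y0; last first.
    rewrite normr0 mulr_ge0 ?sqr_ge0//.
    by have := HC 0 (lexx _); rewrite expR0 mulr1; apply: le_trans.
  have y1 : 0 < y^-1 by rewrite invr_gt0.
  have H : y^-1 ^+ 2 * `|p.[y^-1]| <= C * expR y^-1.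
    rewrite -[y^-1 ^+ 2]ger0_norm ?sqr_ge0// -normrM -hornerXn -hornerM.
    exact: HC (ltW y1).
  rewrite normrM [`|expR _|]ger0_norm ?expR_ge0// expRN ler_pdivrMr ?expR_gt0//.
  by move: H; rewrite exprVn ler_pdivrMl ?exprn_gt0// mulrA [_ * C]mulrC.
Unshelve. all: by end_near. Qed.

Lemma Cdiff_flat n p : Cdiff n (flat p).
Proof.
elim: n p => [|n IH] p; first by move=> x; have [] := is_derive_flat p x.
by exists (flat ('X^2 * (p - p^`())%R)) => //; exact: is_derive_flat.
Qed.

Lemma flat1_ge0 x : 0 <= flat 1 x.
Proof. by rewrite /flat; case: ifP => // _; rewrite hornerC mul1r expR_ge0. Qed.

Lemma flat1_gt0 x : 0 < x -> 0 < flat 1 x.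
Proof. by move=> x0; rewrite /flat x0 hornerC mul1r expR_gt0. Qed.

Lemma flat1_le0 x : x <= 0 -> flat 1 x = 0.
Proof. by rewrite /flat ltNge => ->. Qed.

(** The denominator never vanishes, because x and 1 - x are not both nonpositive. *)
Definition smoothstep (x : R) : R := flat 1 x * (flat 1 x + flat 1 (1 - x))^-1.

Let den_gt0 x : 0 < flat 1 x + flat 1 (1 - x).
Proof.
have [x0|x0] := ltP 0 x; first by rewrite ltr_pwDl ?flat1_gt0 ?flat1_ge0.
by rewrite ltr_wpDl ?flat1_ge0// flat1_gt0// subr_gt0 (le_lt_trans x0).
Qed.

Lemma Cdiff_smoothstep n : Cdiff n smoothstep.
Proof.
apply: CdiffM; first exact: Cdiff_flat.
apply: CdiffV => [x|]; first by rewrite gt_eqF.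
apply: CdiffD; first exact: Cdiff_flat.
have := @Cdiff_affine n (flat 1) (-1) 1 (Cdiff_flat _ _).
by congr Cdiff; apply/funext => x; rewrite mulN1r addrC.
Qed.

Lemma smoothstep_le0 x : x <= 0 -> smoothstep x = 0.
Proof. by move=> x0; rewrite /smoothstep flat1_le0// mul0r. Qed.

Lemma smoothstep_ge1 x : 1 <= x -> smoothstep x = 1.
Proof.
move=> x1; rewrite /smoothstep (@flat1_le0 (1 - x)) ?subr_le0// addr0 mulfV//.
by rewrite gt_eqF// flat1_gt0// (lt_le_trans ltr01).
Qed.

Lemma smoothstep_itv x : 0 <= smoothstep x <= 1.
Proof.
rewrite /smoothstep divr_ge0 ?flat1_ge0 ?(ltW (den_gt0 x))//=.
by rewrite ler_pdivrMr// mul1r lerDl flat1_ge0.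
Qed.

End SmoothFunctions.

(** * Test functions approximating indicators of intervals *)

Section WeakDerivative.
Context {R : realType}.
Local Notation mu := (@lebesgue_measure R).
Local Notation I := (Iopen R).
Implicit Types (f g : R -> R).

Lemma derivable_continuous f : (forall x : R, derivable f x 1) -> continuous f.
Proof.
by move=> df x; apply: differentiable_continuous; exact/derivable1_diffP.
Qed.

Lemma integrableM_bounded (D : set R) f (h : R -> R) (M : R) : measurable D ->
  mu.-integrable D (EFin \o f) -> measurable_fun D h ->
  (forall x, D x -> `|h x| <= M) ->
  mu.-integrable D (fun x => (f x * h x)%:E).
Proof.
move=> mD intf mh hM.
rewrite (_ : (fun x => _) = (EFin \o f) \* (EFin \o h))%E; last exact/funext.
apply: integrableMl => //; exists M; split; first exact: num_real.
by move=> y My x Dx; apply: le_trans (hM _ Dx) (ltW My).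
Qed.

(** For e > 0, a smooth rise from 0 at [c] to 1 at [c + e]; its derivative [dstep] is a one-sided
    mollifier supported in [[c, c + e]]. The expanded argument has the shape used by
    [Cdiff_affine]. *)
Definition step (c e x : R) : R := smoothstep (e^-1 * x + - (e^-1 * c)).
Definition dstep (c e x : R) : R := e^-1 * smoothstep^`()%classic (e^-1 * x + - (e^-1 * c)).

Lemma smoothstep_derivable (x : R) : derivable smoothstep x 1.
Proof. exact: (Cdiff_smoothstep 0%N). Qed.

Lemma is_derive_smoothstep (x : R) : is_derive x 1 smoothstep (smoothstep^`()%classic x).
Proof. by rewrite derive1E; apply: derivableP; exact: smoothstep_derivable. Qed.

Lemma continuous_dsmoothstep : continuous (smoothstep^`()%classic : R -> R).
Proof.
apply: derivable_continuous => x.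
exact: (@Cdiff_derive1n _ 1 smoothstep (Cdiff_smoothstep 1)).
Qed.

Lemma dsmoothstep0 (x : R) : x < 0 \/ 1 < x -> smoothstep^`()%classic x = 0.
Proof.
move=> H; rewrite derive1E.
have : is_derive x 1 smoothstep (0 : R); last by move=> ?; exact: derive_val.
case: H => x0.
  apply: (@near_eq_is_derive _ _ _ (fun=> 0)).
  near=> y; rewrite smoothstep_le0//; apply: ltW.
  by near: y; exact: lt_nbhsl.
apply: (@near_eq_is_derive _ _ _ (fun=> 1 : R)).
near=> y; rewrite smoothstep_ge1//; apply: ltW.
by near: y; exact: lt_nbhsr.
Unshelve. all: by end_near. Qed.

(** The derivative is continuous on [0, 1] and vanishes outside. *)
Lemma dsmoothstep_bound : exists2 M : R, 0 <= M & forall x : R, `|smoothstep^`()%classic x| <= M.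
Proof.
have cont : {within `[0, 1], continuous (fun x : R => `|smoothstep^`()%classic x|)}.
  apply: continuous_subspaceT => x; apply: continuous_comp.
    exact: continuous_dsmoothstep.
  exact: norm_continuous.
have [c _ Hc] := @EVT_max R _ 0 1 ler01 cont.
exists `|smoothstep^`()%classic c|; first by [].
move=> x; have [x0|x0] := ltP x 0; first by rewrite dsmoothstep0 ?normr0//; left.
have [x1|x1] := ltP 1 x; first by rewrite dsmoothstep0 ?normr0//; right.
by apply: Hc; rewrite in_itv/= x0.
Qed.

Lemma is_derive_step (c e x : R) : is_derive x 1 (step c e) (dstep c e x).
Proof.
rewrite /dstep.
have dd := is_deriveD (is_deriveM (is_derive_cst e^-1 x 1) (is_derive_id x 1))
   (is_derive_cst (- (e^-1 * c)) x 1).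
have := @is_derive1_comp _ smoothstep _ x _ _ (is_derive_smoothstep _) dd.
move=> H; apply: (is_derive_eq H); rewrite /GRing.scale /=; ring.
Qed.

Lemma continuous_dstep (c e : R) : continuous (dstep c e).
Proof.
move=> x; apply: cvgM; first exact: cvg_cst.
apply: (cvg_comp (fun x => e^-1 * x + - (e^-1 * c)) smoothstep^`()%classic); last first.
  exact: continuous_dsmoothstep.
by apply: cvgD; [apply: cvgM; [exact: cvg_cst|exact: cvg_id]|exact: cvg_cst].
Qed.

Lemma step_itv (c e x : R) : 0 <= step c e x <= 1.
Proof. exact: smoothstep_itv. Qed.

Lemma step_le (c e x : R) : 0 < e -> x <= c -> step c e x = 0.
Proof.
move=> e0 xc; apply: smoothstep_le0.
by rewrite -mulrBr mulr_ge0_le0 ?invr_ge0 ?(ltW e0)// subr_le0.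
Qed.

Lemma step_ge (c e x : R) : 0 < e -> c + e <= x -> step c e x = 1.
Proof.
move=> e0 xc; apply: smoothstep_ge1.
by rewrite -mulrBr ler_pdivlMl// mulr1 lerBrDl.
Qed.

Lemma dstep0 (c e x : R) : 0 < e -> x < c \/ c + e < x -> dstep c e x = 0.
Proof.
move=> e0 H; rewrite /dstep dsmoothstep0 ?mulr0//; case: H => H.
  by left; rewrite -mulrBr pmulr_rlt0 ?invr_gt0// subr_lt0.
by right; rewrite -mulrBr ltr_pdivlMl// mulr1 ltrBrDl.
Qed.

(** The difference is supported in [[c, d + e]]. As e decreases to 0 it tends to the indicator of
    []c, d]], half-open because [step t e] vanishes at [t]. *)
Lemma test_function_steps (c d e : R) : I c -> 0 < e -> c < d -> I (d + e) ->
  test_function (step c e \- step d e).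
Proof.
move=> Ic e0 cd Id.
have supp : closure [set x | (step c e \- step d e) x != 0] `<=` `[c, d + e].
  rewrite closureE => x; apply; split; first exact: itv_closed.
  move=> y /=; apply: contraR; rewrite in_itv/= negb_and -!ltNge => /orP[yc|yd].
    by rewrite !step_le ?subrr// ltW// (lt_trans yc).
  by rewrite !step_ge ?subrr// ltW// (le_lt_trans _ yd)// lerD2r ltW.
split.
- move=> n x; apply: Cdiff_derive1n.
  have CS t : Cdiff n (step t e) by apply: Cdiff_affine; exact: Cdiff_smoothstep.
  have -> : step c e \- step d e = step c e \+ ((fun=> -1) \* step d e).
    by apply/funext => y /=; rewrite mulN1r.
  by apply: CdiffD => //; apply: CdiffM => //; exact: Cdiff_cst.
- by apply: (subclosed_compact _ (@segment_compact R c (d + e)) supp); exact: closed_closure.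
- apply: (subset_trans supp); rewrite /Iopen; apply: subset_itv.
    by move: Ic; rewrite /Iopen/= in_itv/= => /andP[].
  by move: Id; rewrite /Iopen/= in_itv/= => /andP[].
Qed.

End WeakDerivative.

(** * Mollification at Lebesgue points *)

Section LebesguePoints.
Context {R : realType}.
Local Notation mu := (@lebesgue_measure R).
Local Notation I := (Iopen R).
Local Notation L := (pi / 2 : R).
Implicit Types (f g : R -> R).

Lemma measurable_I : measurable I. Proof. exact: measurable_itv. Qed.
Hint Resolve measurable_I : core.

Lemma itvL : - L < L.
Proof. by have := pi_gt0 R; lra. Qed.

Lemma continuous_integrable_I f : continuous f -> mu.-integrable I (EFin \o f).
Proof.
move=> cf; have H : mu.-integrable `[(- L), L] (EFin \o f).
  apply: continuous_compact_integrable; first exact: segment_compact.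
  exact: continuous_subspaceT.
by apply: integrableS H => //; exact: subset_itv_oo_cc.
Qed.

Lemma Rintegral_I_closed f : continuous f ->
  \int[mu]_(x in I) f x = \int[mu]_(x in Iclosed R) f x.
Proof.
move=> cf; rewrite /Rintegral [in RHS]integral_itv_bndoo//.
apply/measurable_EFinP; apply: measurable_funTS.
exact: continuous_measurable_fun.
Qed.

Lemma parts_I F G f g :
  (forall x : R, is_derive x 1 F (f x)) -> (forall x : R, is_derive x 1 G (g x)) ->
  continuous f -> continuous g ->
  \int[mu]_(x in I) (F x * g x) =
  F L * G L - F (- L) * G (- L) - \int[mu]_(x in I) (f x * G x).
Proof.
move=> dF dG cf cg.
have cont (H h : R -> R) : (forall x : R, is_derive x 1 H (h x)) -> continuous H.
  by move=> dH; apply: derivable_continuous => x; have [] := dH x.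
have LR (H h : R -> R) : (forall x : R, is_derive x 1 H (h x)) ->
    derivable_oo_LRcontinuous H (- L) L.
  move=> dH; split; first by move=> x _; have [] := dH x.
    by apply: cvg_at_right_filter; exact: (cont _ _ dH).
  by apply: cvg_at_left_filter; exact: (cont _ _ dH).
have D (H h : R -> R) : (forall x : R, is_derive x 1 H (h x)) ->
    {in `](- L), L[, H^`()%classic =1 h}.
  by move=> dH x _; rewrite derive1E; exact: derive_val.
have cF := cont _ _ dF; have cG := cont _ _ dG.
have cFg : continuous (fun x => F x * g x).
  by move=> x; apply: cvgM; [exact: cF|exact: cg].
have cfG : continuous (fun x => f x * G x).
  by move=> x; apply: cvgM; [exact: cf|exact: cG].
rewrite (Rintegral_I_closed cFg) (Rintegral_I_closed cfG).
apply: Rintegration_by_parts; first exact: itvL.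
- exact: continuous_subspaceT.
- exact: LR dF.
- exact: D.
- exact: continuous_subspaceT.
- exact: LR dG.
- exact: D.
Qed.

(** Integration by parts against the constant 1 leaves the increment of [step c e] between the
    endpoints of [I]. *)
Lemma dstep_integral (c e : R) : 0 < e -> I c -> I (c + e) ->
  \int[mu]_(x in I) dstep c e x = 1.
Proof.
move=> e0 Ic Ice.
move: Ic Ice; rewrite /Iopen/= !in_itv/= => /andP[c1 c2] /andP[c3 c4].
have d1 (x : R) : is_derive x 1 (fun=> 1 : R) (0 : R) by exact: is_derive_cst.
have := parts_I d1 (@is_derive_step R c e) (@cst_continuous _ _ _) (@continuous_dstep R c e).
under eq_Rintegral do rewrite mul1r.
move=> ->; rewrite step_ge//; last exact: ltW.
rewrite step_le//; last exact: ltW.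
under eq_Rintegral do rewrite mul0r.
by rewrite Rintegral_cst// mul0r !mul1r !subr0.
Qed.

(* [dstep c e] is supported in the ball of radius [2 e] and bounded by [M / e], so the
   error is at most a multiple of the mean deviation of [f] on that ball. *)
Lemma dstep_cvg f (c : R) : mu.-integrable I (EFin \o f) -> I c ->
  lebesgue_pt (f \_ I) c ->
  \int[mu]_(x in I) (f x * dstep c e x) @[e --> 0^'+] --> f c.
Proof.
move=> intf Ic.
have := @dsmoothstep_bound R; case=> M M0 HM.
move: (Ic); rewrite /Iopen/= in_itv/= => /andP[c1 c2].
rewrite /lebesgue_pt => /(cvg_comp (fun e => 2 * e) _) leb.
have {}leb : davg (f \_ I) c (2 * e) @[e --> 0^'+] --> 0%E.
  apply: leb => P [r /= r0 HP]; exists (r / 2); first by rewrite /= divr_gt0.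
  move=> e; rewrite /ball_/= => er e0; apply: HP; last by rewrite /= mulr_gt0.
  rewrite /ball_/= sub0r normrN normrM (ger0_norm (ler0n _ 2)).
  by move: er; rewrite sub0r normrN ltr_pdivlMr// mulrC.
(* The factor [4 * M] is the kernel bound [M / e] times the length [4 e] of the ball. *)
have key : \forall e \near 0^'+, (`|\int[mu]_(x in I) (f x * dstep c e x) - f c|%:E <=
    (4 * M)%:E * davg (f \_ I) c (2 * e))%E.
  near=> e.
  have e0 : 0 < e by [].
  have e20 : 0 < 2 * e by rewrite mulr_gt0.
  have eL : 2 * e < L - c.
    rewrite mulrC -ltr_pdivlMr//; near: e; apply: nbhs_right_lt.
    by rewrite divr_gt0// subr_gt0.
  have eL' : 2 * e < c + L.
    rewrite mulrC -ltr_pdivlMr//; near: e; apply: nbhs_right_lt.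
    by rewrite divr_gt0// -ltrBlDr sub0r.
  have Ice : I (c + e).
    by rewrite /Iopen/= in_itv/=; apply/andP; split; lra.
  have ball_I : ball c (2 * e) `<=` I.
    move=> x; rewrite ball_itv /Iopen /= !in_itv/= => /andP[h1 h2].
    by apply/andP; split; lra.
  have mk : measurable_fun I (dstep c e).
    by apply: measurable_funTS; apply: continuous_measurable_fun; exact: continuous_dstep.
  have kb x : `|dstep c e x| <= e^-1 * M.
    by rewrite normrM gtr0_norm ?invr_gt0// ler_wpM2l// ltW// invr_gt0.
  have i1 : mu.-integrable I (fun x => (f x * dstep c e x)%:E).
    exact: (@integrableM_bounded _ _ _ _ (e^-1 * M)).
  have i2 : mu.-integrable I (fun x => (f c * dstep c e x)%:E).
    apply: (@integrableM_bounded _ _ (fun=> f c) _ (e^-1 * M)) => //.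
    by apply: continuous_integrable_I; exact: cst_continuous.
  (* The kernel has mass one, which brings [f c] under the integral. *)
  have -> : \int[mu]_(x in I) (f x * dstep c e x) - f c =
      \int[mu]_(x in I) ((f x - f c) * dstep c e x).
    under [RHS]eq_Rintegral do rewrite mulrBl.
    rewrite RintegralB// RintegralZl ?dstep_integral ?mulr1//.
    by apply: continuous_integrable_I; exact: continuous_dstep.
  have i3 : mu.-integrable I (fun x => ((f x - f c) * dstep c e x)%:E).
    by under eq_fun do rewrite mulrBl EFinB; exact: integrableB.
  rewrite EFin_normr_Rintegral//.
  have mfI : measurable_fun setT (fun x => ((f \_ I) x - (f \_ I) c)%:E).
    apply/measurable_EFinP; apply: measurable_funB => //.
    apply/(measurable_restrictT _ _).1 => //.
    by apply/measurable_EFinP; exact: measurable_int intf.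
  apply: le_trans (le_abse_integral _ _ _) _ => //; first exact: measurable_int i3.
  apply: (@le_trans _ _ (\int[mu]_(x in I)
      ((fun x => (e^-1 * M)%:E * `|((f \_ I) x - (f \_ I) c)%:E|) \_ (ball c (2 * e))) x)%E).
    have mh : measurable_fun setT (fun x => (e^-1 * M)%:E * `|((f \_ I) x - (f \_ I) c)%:E|)%E.
      by apply: measurable_funeM; exact: measurableT_comp.
    apply: ge0_le_integral => //.
    - by apply: measurableT_comp => //; exact: measurable_int i3.
    - apply: measurable_funTS; apply/(measurable_restrictT _ _).1 => //.
        exact: measurable_ball.
      exact: measurable_funTS.
    - move=> x Ix; rewrite patchE; case: ifPn => xb.
        rewrite !patchE !mem_set// lee_fin normrM mulrC.
        by rewrite ler_wpM2r.
      rewrite dstep0 ?mulr0 ?abse0//.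
      move: xb; rewrite notin_setE ball_itv/= in_itv/= => /negP.
      by rewrite negb_and -!leNgt => /orP[?|?]; [left|right]; lra.
  rewrite -integral_mkcondr setIidr//.
  have mball : measurable (ball c (2 * e)) by exact: measurable_ball.
  rewrite ge0_integralZl_EFin//; first last.
  - by rewrite mulr_ge0// invr_ge0 ltW.
  - apply: measurableT_comp => //; exact: measurable_funTS.
  rewrite /davg /iavg lebesgue_measure_ball; last exact: ltW.
  rewrite inver ifF; last by apply/negbTE; rewrite mulrn_eq0/= gt_eqF.
  rewrite muleA -EFinM (_ : 4 * M * _ = e^-1 * M)//.
  by rewrite -mulr_natl; field; rewrite gt_eqF.
have sc : (fun e => (4 * M)%:E * davg (f \_ I) c (2 * e))%E @ 0^'+ --> 0%:E.
  by rewrite -[0%:E](mule0 (4 * M)%:E); exact: cvgeZl.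
have [fi /cvgr0Pnorm_le fl] := (fine_cvgP _ _).1 sc.
apply/cvgrPdist_le => eps eps0; have {}fl := fl _ eps0.
near=> e; rewrite distrC.
have H1 : `|fine ((4 * M)%:E * davg (f \_ I) c (2 * e))%E| <= eps by near: e.
have H2 : ((4 * M)%:E * davg (f \_ I) c (2 * e))%E \is a fin_num by near: e.
have H3 : (`|\int[mu]_(x in I) (f x * dstep c e x) - f c|%:E <= ((4 * M)%:E * davg (f \_ I) c (2 * e)))%E by near: e.
move: H1 H2 H3; set X := ((4 * M)%:E * davg (f \_ I) c (2 * e))%E => H1 H2 H3.
apply: le_trans H1; rewrite -lee_fin.
by apply: (le_trans H3); rewrite -{1}(fineK H2) lee_fin ler_norm.
Unshelve. all: by end_near. Qed.

End LebesguePoints.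

(** * Weak derivatives on the interval *)

Section WeakPrimitive.
Context {R : realType}.
Local Notation mu := (@lebesgue_measure R).
Local Notation I := (Iopen R).
Local Notation L := (pi / 2 : R).
Implicit Types (f g h : R -> R).
Let measI : measurable I. Proof. exact: measurable_I. Qed.

Definition weak_pair f g : Prop := forall phi, test_function phi ->
  \int[mu]_(x in I) (f x * phi^`()%classic x) = - \int[mu]_(x in I) (g x * phi x).

(** Otherwise the exceptional null set would contain an interval of positive length. *)
Lemma ae_exists_itv (a b : R) (P : R -> Prop) : a < b ->
  (\forall x \ae mu, P x) -> exists2 x, a < x < b & P x.
Proof.
move=> ab aeP; apply: contrapT => nP.
have N : mu.-negligible `]a, b[.
  apply: negligibleS aeP => x; rewrite /= in_itv/= => xab Px.
  by apply: nP; exists x.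
have : mu `]a, b[%classic = 0%E by apply: measure_negligible N; exact: measurable_itv.
rewrite lebesgue_measure_itv/= lte_fin ab -EFinD => -[] /eqP.
by rewrite subr_eq0 gt_eqF.
Qed.

Lemma ae_eq_continuous f g : {within Iclosed R, continuous f} ->
  {within Iclosed R, continuous g} ->
  (\forall x \ae mu, I x -> f x = g x) -> forall x, Iclosed R x -> f x = g x.
Proof.
move=> cf cg fg x Ix; apply/eqP; rewrite -subr_eq0; apply: contrapT => /negP h0.
have cfg : {within Iclosed R, continuous (f \- g)}.
  by move=> y; apply: cvgB; [exact: cf|exact: cg].
move/subspace_continuousP : cfg => /(_ x Ix) /= /cvgrPdist_lt.
move=> /(_ `|f x - g x|); rewrite normr_gt0 => /(_ h0).
move=> [d /= d0 Hd].
move: (Ix); rewrite /Iclosed/= in_itv/= => /andP[x1 x2].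
have LL := @itvL R.
(* The interval is cut down to [I], since [x] may be an endpoint. *)
have [y] : exists2 y, Num.max (x - d) (- L) < y < Num.min (x + d) L & (I y -> f y = g y).
  apply: ae_exists_itv fg.
  by rewrite gt_max !lt_min; apply/andP; split; apply/andP; split; lra.
rewrite gt_max lt_min => /andP[/andP[y1 y2] /andP[y3 y4]] fgy.
have Iy : I y by rewrite /Iopen/= in_itv/= y2.
have : `|(f x - g x) - (f y - g y)| < `|f x - g x|.
  apply: Hd; last by rewrite /Iclosed/= in_itv/= !ltW.
  by rewrite /ball_/= ltr_distlC y1.
by rewrite fgy// subrr subr0 ltxx.
Qed.

(** Turns limits as e decreases to 0 into limits of sequences, the form required by dominated
    convergence. *)
Lemma harmonic_at_right : harmonic @ \oo --> (0 : R)^'+.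
Proof.
move=> P [e /= e0 HP]; have /cvgrPdist_lt/(_ _ e0) := @cvg_harmonic R.
by apply: filterS => n Hn; apply: HP => //=; rewrite /harmonic invr_gt0.
Qed.

Lemma step_cvg (c x : R) :
  (fun n => step c (@harmonic R n) x) @ \oo --> ((c < x)%R%:R : R).
Proof.
have [cx|xc] := ltP c x; last first.
  rewrite (_ : (fun n => _) = fun=> 0); first exact: cvg_cst.
  by apply/funext => n; rewrite step_le// invr_gt0.
have H : \forall e \near (0 : R)^'+, c + e <= x.
  near=> e; rewrite -lerBrDl ltW//; near: e; apply: nbhs_right_lt.
  by rewrite subr_gt0.
have {}H := harmonic_at_right H.
apply: (cvg_trans _ (@cvg_cst _ (1 : R) _ \oo _)).
apply: near_eq_cvg; near=> n; rewrite step_ge//; first by rewrite invr_gt0.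
by near: n.
Unshelve. all: by end_near. Qed.

(** In the relation tested on [step c e \- step d e], the side of [f] converges because [dstep] is a
    mollifier at Lebesgue points, and the side of [g] by domination by |g|, the difference of two
    steps lying in [-1, 1]. *)
Lemma weak_increment f g (c d : R) :
  mu.-integrable I (EFin \o f) -> mu.-integrable I (EFin \o g) ->
  weak_pair f g -> I c -> I d -> c < d ->
  lebesgue_pt (f \_ I) c -> lebesgue_pt (f \_ I) d ->
  f d - f c = \int[mu]_(x in `]c, d]) (g \_ I) x.
Proof.
move=> fi gi wfg Ic Id cd lc ld.
move: (Ic) (Id); rewrite /Iopen/= !in_itv/= => /andP[c1 c2] /andP[d1 d2].
pose e := @harmonic R.
have A := cvg_comp _ _ harmonic_at_right (dstep_cvg fi Ic lc).
have B := cvg_comp _ _ harmonic_at_right (dstep_cvg fi Id ld).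
have AB := cvgB B A.
have ms t n : measurable_fun I (step t (e n)).
  apply: measurable_funTS; apply: continuous_measurable_fun.
  by apply: derivable_continuous => x; have [] := is_derive_step t (e n) x.
have mdf t n : measurable_fun I (dstep t (e n)).
  apply: measurable_funTS; apply: continuous_measurable_fun; exact: continuous_dstep.
have mg : measurable_fun I (EFin \o g) by exact: measurable_int gi.
have mg' : measurable_fun I g by apply/measurable_EFinP.
have mi (t : R) : measurable_fun I (fun x => (t < x)%R%:R : R).
  rewrite (_ : (fun x => _) = \1_(`]t, +oo[%classic : set R)); last first.
    by apply/funext => x; rewrite indicE mem_setE in_itv/= andbT.
  by apply: measurable_funTS; apply: measurable_indic; exact: measurable_itv.
have st t n x : 0 <= step t (e n) x <= 1 by exact: step_itv.
have [iJ G] : mu.-integrable I (fun x => (g x * ((c < x)%R%:R - (d < x)%R%:R))%:E) /\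
  (fun n => \int[mu]_(x in I) (g x * (step c (e n) x - step d (e n) x))%:E)%E @ \oo
    --> (\int[mu]_(x in I) (g x * ((c < x)%R%:R - (d < x)%R%:R))%:E)%E.
  have [] // := @dominated_convergence _ _ _ mu I measI
    (fun n x => (g x * (step c (e n) x - step d (e n) x))%:E)
    (fun x => (g x * ((c < x)%R%:R - (d < x)%R%:R))%:E) (fun x => `|g x|%:E).
  - move=> n; apply/measurable_EFinP; apply: measurable_funM => //.
    by apply: measurable_funB; exact: ms.
  - apply/measurable_EFinP; apply: measurable_funM => //.
    by apply: measurable_funB; exact: mi.
  - apply: aeW => x _; apply: cvg_EFin; first exact: nearW.
    by apply: cvgM; [exact: cvg_cst|apply: cvgB; exact: step_cvg].
  - exact: integrable_norm gi.
  - apply: aeW => x n _; rewrite lee_fin normrM ler_piMr// ler_norml.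
    by have /andP[? ?] := st c n x; have /andP[? ?] := st d n x; apply/andP; split; lra.
pose J := \int[mu]_(x in I) (g x * ((c < x)%R%:R - (d < x)%R%:R)).
have {}G : (fun n => \int[mu]_(x in I) (g x * (step c (e n) x - step d (e n) x))) @ \oo --> J.
  by apply: fine_cvg; rewrite fineK//; exact: integrable_fin_num.
have JE : J = \int[mu]_(x in `]c, d]) (g \_ I) x.
  rewrite /J Rintegral_mkcond [RHS]Rintegral_mkcond.
  apply: eq_Rintegral => x _; rewrite !patchE.
  have [xI|xI] := boolP (x \in I); last by case: ifP.
  rewrite mem_setE in_itv/=; have [cx|cx] := ltP c x; last first.
    by rewrite (le_gtF (le_trans cx (ltW cd))) subrr mulr0.
  by have [dx|dx] := ltP d x; rewrite ?subrr ?subr0 ?mulr0 ?mulr1.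
have E : \forall n \near \oo, \int[mu]_(x in I) (f x * dstep d (e n) x) -
    \int[mu]_(x in I) (f x * dstep c (e n) x) =
    \int[mu]_(x in I) (g x * (step c (e n) x - step d (e n) x)).
  have eL : \forall h \near (0 : R)^'+, d + h < L.
    near=> h; rewrite -ltrBrDl; near: h; apply: nbhs_right_lt.
    by rewrite subr_gt0.
  have {}eL := harmonic_at_right eL.
  near=> n.
  have en0 : 0 < e n by rewrite invr_gt0.
  have Ide : I (d + e n).
    rewrite /Iopen/= in_itv/=; apply/andP; split; first lra.
    by near: n.
  have [M _ HM] := @dsmoothstep_bound R.
  have fd t : mu.-integrable I (fun x => (f x * dstep t (e n) x)%:E).
    apply: (@integrableM_bounded _ _ _ _ ((e n)^-1 * M)) => // x _.
    by rewrite normrM gtr0_norm ?invr_gt0// ler_wpM2l// ltW// invr_gt0.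
  have := wfg _ (test_function_steps Ic en0 cd Ide).
  move=> /(congr1 -%R); rewrite opprK => <-.
  rewrite -opprB; congr (- _); rewrite -RintegralB; [|by []|exact: fd|exact: fd].
  apply: eq_Rintegral => x _; rewrite -mulrBr; congr (_ * _).
  rewrite derive1E.
  by have [_ ->] := is_deriveB (is_derive_step c (e n) x) (is_derive_step d (e n) x).
have EJ : (fun n => \int[mu]_(x in I) (f x * dstep d (e n) x) -
    \int[mu]_(x in I) (f x * dstep c (e n) x)) @ \oo --> J.
  by apply: (cvg_trans _ G); apply: near_eq_cvg; apply: filterS E => n ->.
rewrite -JE -(cvg_lim (@Rhausdorff R) EJ); apply/esym.
by apply: cvg_lim => //; exact: AB.
Unshelve. all: by end_near. Qed.

(** The primitive of [g] is normalised at one Lebesgue point [c] of [f]; [weak_increment] identifies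
    it with [f] at all the others. The third clause, obtained at Lebesgue points of [g], serves
    uniqueness of weak derivatives; the last yields a classical derivative at every point and serves
    regularity. *)
Lemma weak_primitive f g :
  mu.-integrable I (EFin \o f) -> mu.-integrable I (EFin \o g) ->
  weak_pair f g -> exists F : R -> R,
  [/\ {within Iclosed R, continuous F},
      (\forall x \ae mu, I x -> f x = F x),
      (\forall x \ae mu, I x -> is_derive x 1 F (g x)) &
      forall h, {in I, continuous h} -> (\forall x \ae mu, I x -> g x = h x) ->
        forall x, I x -> is_derive x 1 F (h x)].
Proof.
move=> fi gi wfg.
have leb := lebesgue_differentiation (integrable_locally measI fi).
have [c cI lc] := ae_exists_itv (@itvL R) leb.
have Ic : I c by rewrite /Iopen/= in_itv.
have LL := @itvL R.
have giT : mu.-integrable setT (EFin \o (g \_ I)).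
  rewrite -restrict_EFin.
  by apply/integrable_restrict => //=; rewrite setTI.
have giS (b1 b2 : itv_bound R) : mu.-integrable [set` Interval b1 b2] (EFin \o (g \_ I)).
  by apply: integrableS giT => //; exact: measurable_itv.
pose G x := \int[mu]_(t in `[(- L), x]) (g \_ I) t.
pose F x := f c - G c + G x.
exists F; split.
- move=> x; apply: cvgD; first exact: cvg_cst.
  exact: (parameterized_integral_continuous (ltW LL) (giS _ _)).
- apply: filterS leb => x lx Ix; rewrite /F.
  have GB a b : - L <= a -> a <= b -> G b - G a = \int[mu]_(t in `]a, b]) (g \_ I) t.
    by move=> La ab; rewrite /G Rintegral_itvB.
  move: (cI) (Ix); rewrite /Iopen/= in_itv/= => /andP[c1 c2] /andP[x1 x2].
  have [xc|cx|->] := ltgtP x c; last by rewrite subrK.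
    have := weak_increment fi gi wfg Ix Ic xc lx lc.
    by rewrite -GB ?ltW//; lra.
  have := weak_increment fi gi wfg Ic Ix cx lc lx.
  by rewrite -GB ?ltW//; lra.
- have := lebesgue_differentiation (integrable_locally measI gi).
  apply: filterS => x lx Ix; move: (Ix); rewrite /Iopen/= in_itv/= => /andP[x1 x2].
  have [dG Gx] := @FTC1_lebesgue_pt _ _ (BLeft (- L)) _ _ x2 (giS _ _) x1 lx.
  have dGx : is_derive x 1 G (g x).
    by apply: DeriveDef; [exact: dG|rewrite -derive1E Gx patchE mem_set].
  by have := is_deriveD (is_derive_cst (f c - G c) x 1) dGx; rewrite add0r.
- move=> h ch gh x Ix.
  move: (Ix); rewrite /Iopen/= in_itv/= => /andP[x1 x2].
  have mg : measurable_fun setT (g \_ I).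
    by apply/measurable_EFinP; exact: measurable_int giT.
  have mh : measurable_fun setT (h \_ I).
    apply/(measurable_restrictT _ _).1 => //.
    by apply: open_continuous_measurable_fun => //; exact: interval_open.
  have ghI : \forall x \ae mu, (g \_ I) x = (h \_ I) x.
    by apply: filterS gh => y gh; rewrite !patchE; case: ifPn => // /set_mem; exact: gh.
  (* Replacing [g] by [h] does not change the integral, and the fundamental theorem then applies
     wherever [h] is continuous. *)
  have GE : G = fun x => \int[mu]_(t in `[(- L), x]) (h \_ I) t.
    apply/funext => y; rewrite /G /Rintegral; congr fine.
    apply: ae_eq_integral => //.
    - by apply/measurable_EFinP; exact: measurable_funTS.
    - by apply/measurable_EFinP; exact: measurable_funTS.
    - by apply: filterS ghI => z ghz _; rewrite /= ghz.
  have hi : mu.-integrable `[(- L), L] (EFin \o (h \_ I)).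
    have /integrableP[m1 i1] := giS (BLeft (- L)) (BRight L).
    have m2 : measurable_fun `[(- L), L] (EFin \o (h \_ I)).
      by apply/measurable_EFinP; exact: measurable_funTS.
    apply/integrableP; split => //.
    apply: le_lt_trans i1; rewrite le_eqVlt; apply/orP; left; apply/eqP.
    apply: ae_eq_integral => //; [exact: measurableT_comp|exact: measurableT_comp|].
    by apply: filterS ghI => z ghz _; rewrite /= ghz.
  have chx : {for x, continuous (h \_ I)}.
    rewrite /prop_for /continuous_at patchE mem_set//.
    apply: (cvg_trans _ (ch x (mem_set Ix))); apply: near_eq_cvg.
    have nI : \forall y \near x, I y.
      by apply: open_nbhs_nbhs; split => //; exact: interval_open.
    by apply: filterS nI => y Iy; rewrite patchE mem_set.
  have [dG Gx] := continuous_FTC1_closed x2 hi x1 chx.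
  have dGx : is_derive x 1 G (h x).
    rewrite GE; apply: DeriveDef; first exact: dG.
    by rewrite -derive1E Gx patchE mem_set.
  have := is_deriveD (is_derive_cst (f c - G c) x 1) dGx.
  by rewrite add0r.
Qed.

(** The two primitives are continuous and agree almost everywhere, hence on the whole closed
    interval; so their derivatives agree where both are known. *)
Lemma weak_pair_unique f g h : mu.-integrable I (EFin \o f) ->
  mu.-integrable I (EFin \o g) -> mu.-integrable I (EFin \o h) ->
  weak_pair f g -> weak_pair f h -> \forall x \ae mu, I x -> g x = h x.
Proof.
move=> fi gi hi fg fh.
have [F [cF fF dF _]] := weak_primitive fi gi fg.
have [G [cG fG dG _]] := weak_primitive fi hi fh.
have FG : \forall x \ae mu, I x -> F x = G x.
  by apply: filterS2 fF fG => x fF fG Ix; rewrite -fF// fG.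
have {}FG := ae_eq_continuous cF cG FG.
apply: filterS2 dF dG => x dF dG Ix.
have dFx := dF Ix; have dGx := dG Ix.
suff : is_derive x 1 F (h x) by have [_ <-] := dFx; case.
apply: (near_eq_is_derive _ dGx).
have nI : \forall y \near x, I y.
  by apply: open_nbhs_nbhs; split => //; exact: interval_open.
apply: filterS nI => y Iy; apply/esym/FG; exact: subset_itv_oo_cc Iy.
Qed.

Lemma weak_pair_ae f f' g g' : measurable_fun I f -> measurable_fun I f' ->
  measurable_fun I g -> measurable_fun I g' ->
  (\forall x \ae mu, I x -> f x = f' x) -> (\forall x \ae mu, I x -> g x = g' x) ->
  weak_pair f g -> weak_pair f' g'.
Proof.
move=> mf mf' mg mg' ff' gg' fg phi tphi; have := fg phi tphi.
have [dphi _ _] := tphi.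
have m0 : measurable_fun I phi.
  apply: measurable_funTS; apply: continuous_measurable_fun.
  by apply: derivable_continuous; exact: dphi 0%N.
have m1 : measurable_fun I phi^`()%classic.
  apply: measurable_funTS; apply: continuous_measurable_fun.
  by apply: derivable_continuous; exact: dphi 1%N.
have E (h h' k : R -> R) : measurable_fun I h -> measurable_fun I h' -> measurable_fun I k ->
    (\forall x \ae mu, I x -> h x = h' x) ->
    \int[mu]_(x in I) (h x * k x) = \int[mu]_(x in I) (h' x * k x).
  move=> mh mh' mk hh'; congr fine; apply: ae_eq_integral => //.
  - by apply/measurable_EFinP; exact: measurable_funM.
  - by apply/measurable_EFinP; exact: measurable_funM.
  - by apply: filterS hh' => x hh' Ix; rewrite hh'.
by rewrite (E _ _ _ mf mf' m1 ff') (E _ _ _ mg mg' m0 gg').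
Qed.

(** The endpoints do not belong to [I], so a test function vanishes there and integration by parts
    has no boundary terms. *)
Lemma weak_pair_C1 F f : (forall x : R, is_derive x 1 F (f x)) -> continuous f ->
  weak_pair F f.
Proof.
move=> dF cf phi [dphi _ supp].
have z x : ~ I x -> phi x = 0.
  move=> nI; apply: contrapT => /eqP p0; apply: nI; apply: supp.
  exact: subset_closure.
have dp (x : R) : is_derive x 1 phi (phi^`()%classic x).
  by rewrite derive1E; apply: derivableP; exact: (dphi 0%N).
have cp : continuous phi^`()%classic by apply: derivable_continuous; exact: dphi 1%N.
rewrite (parts_I dF dp cf cp) !z ?mulr0 ?subr0 ?sub0r// /Iopen/= in_itv/= ?ltxx//.
by rewrite andbF.
Qed.

End WeakPrimitive.

(** * Regularity for the operator *)

Section ComplexLayer.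
Context {R : realType}.
Local Notation mu := (@lebesgue_measure R).
Local Notation I := (Iopen R).
Local Notation C := R[i].
Implicit Types (u v w : L2 R) (y z : R -> R[i]).
Local Open Scope quotient_scope.
Let measI : measurable I. Proof. exact: measurable_I. Qed.

Lemma cReM (a b : C) : complex.Re (a * b) =
  complex.Re a * complex.Re b - complex.Im a * complex.Im b.
Proof. by case: a b => [? ?] [? ?]. Qed.

Lemma cImM (a b : C) : complex.Im (a * b) =
  complex.Re a * complex.Im b + complex.Im a * complex.Re b.
Proof. by case: a b => [? ?] [? ?]. Qed.

Lemma cReD (a b : C) : complex.Re (a + b) = complex.Re a + complex.Re b.
Proof. by case: a b => [? ?] [? ?]. Qed.

Lemma cImD (a b : C) : complex.Im (a + b) = complex.Im a + complex.Im b.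
Proof. by case: a b => [? ?] [? ?]. Qed.

Lemma L2_ext u v : (\forall x \ae mu, I x -> u x = v x) -> u = v.
Proof. by move=> uv; rewrite -[u]reprK -[v]reprK; apply/L2_eqP. Qed.

Lemma L2_addE u v : \forall x \ae mu, I x -> (u + v : L2 R) x = u x + v x.
Proof.
have E : u + v = \pi_(L2 R) (repr u + repr v) by rewrite -pi_L2D !reprK.
by apply: filterS (L2_reprE (repr u + repr v)) => x H Ix; rewrite E; exact: H.
Qed.

Lemma L2_scaleE (c : C) u : \forall x \ae mu, I x -> (c *: u : L2 R) x = c * u x.
Proof. exact: L2_reprE. Qed.

Lemma L2_oppE u : \forall x \ae mu, I x -> (- u : L2 R) x = - u x.
Proof.
rewrite -scaleN1r; apply: filterS (L2_scaleE (-1) u) => x H Ix.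
by rewrite H// mulN1r.
Qed.

Lemma L2_zeroE : \forall x \ae mu, I x -> (0 : L2 R) x = 0.
Proof.
rewrite -(scale0r (0 : L2 R)); apply: filterS (L2_scaleE 0 0) => x H Ix.
by rewrite H// mul0r.
Qed.

Lemma L2_square_integrable u : square_integrable u.
Proof. by have := valP (repr u); rewrite inE. Qed.

Lemma L2_measurable u : measurable_fun I (fun x => complex.Re (u x)) /\
  measurable_fun I (fun x => complex.Im (u x)).
Proof. by have [] := L2_square_integrable u. Qed.

Lemma normc_sqr (a : C) :
  Normc.normc a ^+ 2 = complex.Re a ^+ 2 + complex.Im a ^+ 2.
Proof. by case: a => p q /=; rewrite sqr_sqrtr// addr_ge0 ?sqr_ge0. Qed.

Lemma measurable_normc_sqr y : cmeasurable y ->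
  measurable_fun I (fun x => Normc.normc (y x) ^+ 2).
Proof.
move=> [mr mi]; under eq_fun do rewrite normc_sqr.
by apply: measurable_funD; apply: measurable_funX.
Qed.

(** Each component is bounded by 1 + |u|^2, which is integrable because [I] has finite length. *)
Lemma L2_integrable u : mu.-integrable I (EFin \o (fun x => complex.Re (u x))) /\
  mu.-integrable I (EFin \o (fun x => complex.Im (u x))).
Proof.
have [[mr mi] su] := L2_square_integrable u.
have i1 : mu.-integrable I (EFin \o (fun=> 1 : R)).
  by apply: continuous_integrable_I; exact: cst_continuous.
have i2 : mu.-integrable I (EFin \o (fun x => Normc.normc (u x) ^+ 2)).
  apply/integrableP; split.
    by apply/measurable_EFinP; exact: measurable_normc_sqr.
  apply: le_lt_trans su; rewrite le_eqVlt; apply/orP; left; apply/eqP.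
  by apply: eq_integral => x _; rewrite /= ger0_norm// sqr_ge0.
have iB : mu.-integrable I (EFin \o (fun x => 1 + Normc.normc (u x) ^+ 2)).
  by apply: (integrableD _ i1 i2); exact: measurable_itv.
have bnd (a b : R) : `|a| <= `|1 + (a ^+ 2 + b ^+ 2)|.
  rewrite [leRHS]ger0_norm ?addr_ge0 ?sqr_ge0//.
  have := sqr_ge0 (`|a| - 1); have := sqr_ge0 b; have := sqr_ge0 a.
  by rewrite sqrrB1 -(real_normK (num_real a)); lra.
split; apply: (le_integrable _ _ _ iB).
- exact: measurable_itv.
- exact/measurable_EFinP.
- by move=> x _; rewrite lee_fin normc_sqr.
- exact: measurable_itv.
- exact/measurable_EFinP.
- by move=> x _; rewrite lee_fin normc_sqr [X in 1 + X]addrC; exact: bnd.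
Qed.

(** Test functions are real-valued, so the complex relation splits into its components. *)
Lemma is_weak_derivativeP u v : is_weak_derivative u v <->
  weak_pair (fun x => complex.Re (u x)) (fun x => complex.Re (v x)) /\
  weak_pair (fun x => complex.Im (u x)) (fun x => complex.Im (v x)).
Proof.
have RE y (h : R -> R) : \int[mu]_(x in I) complex.Re (y x * (h x)%:C%C) =
    \int[mu]_(x in I) (complex.Re (y x) * h x).
  by apply: eq_Rintegral => x _; rewrite cReM /= mulr0 subr0.
have IE y (h : R -> R) : \int[mu]_(x in I) complex.Im (y x * (h x)%:C%C) =
    \int[mu]_(x in I) (complex.Im (y x) * h x).
  by apply: eq_Rintegral => x _; rewrite cImM /= mulr0 add0r.
split=> [uv|[h1 h2] phi tphi].
  by split => phi /uv; rewrite /cintegral !RE !IE => -[].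
by rewrite /cintegral !RE !IE h1// h2.
Qed.

Lemma is_weak_derivative_unique u v w :
  is_weak_derivative u v -> is_weak_derivative u w -> v = w.
Proof.
move=> /is_weak_derivativeP[r1 i1] /is_weak_derivativeP[r2 i2].
have [ur ui] := L2_integrable u; have [vr vi] := L2_integrable v.
have [wr wi] := L2_integrable w.
apply: L2_ext; apply: filterS2 (weak_pair_unique ur vr wr r1 r2)
  (weak_pair_unique ui vi wi i1 i2) => x h1 h2 Ix.
by move: (h1 Ix) (h2 Ix); case: (v x) (w x) => [? ?] [? ?] /= -> ->.
Qed.

Lemma wderiv_eq u v : is_weak_derivative u v -> wderiv u = v.
Proof.
move=> uv; apply: (@is_weak_derivative_unique u) => //.
by rewrite /wderiv; case: xgetP => [w _ //|/(_ v)]; exact: (fun h => h).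
Qed.

Lemma wderivP u : H1 u -> is_weak_derivative u (wderiv u).
Proof. by move=> [v uv]; rewrite (wderiv_eq uv). Qed.

End ComplexLayer.

Section Regularity.
Context {R : realType}.
Local Notation mu := (@lebesgue_measure R).
Local Notation I := (Iopen R).
Local Notation L := (pi / 2 : R).
Implicit Types (u v w : L2 R) (y z : R -> R[i]).
Local Open Scope quotient_scope.

Definition cderiv y z (x : R) : Prop :=
  is_derive x 1 (fun t => complex.Re (y t)) (complex.Re (z x)) /\
  is_derive x 1 (fun t => complex.Im (y t)) (complex.Im (z x)).

Definition ccontinuous y : Prop :=
  continuous (fun t => complex.Re (y t)) /\ continuous (fun t => complex.Im (y t)).

Definition ccontinuous_closed y : Prop :=
  {within Iclosed R, continuous (fun t => complex.Re (y t))} /\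
  {within Iclosed R, continuous (fun t => complex.Im (y t))}.

Definition ae_equal (y z : R -> R[i]) : Prop :=
  \forall x \ae mu, I x -> y x = z x.

Lemma ae_equal_sym y z : ae_equal y z -> ae_equal z y.
Proof. by apply: filterS => x yz Ix; rewrite yz. Qed.

Lemma ae_equal_trans y z (t : R -> R[i]) : ae_equal y z -> ae_equal z t -> ae_equal y t.
Proof. by apply: filterS2 => x yz zt Ix; rewrite yz// zt. Qed.

Lemma ae_equal_Re y z : ae_equal y z ->
  \forall x \ae mu, I x -> complex.Re (y x) = complex.Re (z x).
Proof. by apply: filterS => x yz Ix; rewrite yz. Qed.

Lemma ae_equal_Im y z : ae_equal y z ->
  \forall x \ae mu, I x -> complex.Im (y x) = complex.Im (z x).
Proof. by apply: filterS => x yz Ix; rewrite yz. Qed.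

Lemma cderiv_continuous y z : (forall x, cderiv y z x) -> ccontinuous y.
Proof.
move=> dy; split; apply: derivable_continuous => x; have [dr di] := dy x.
  by have [] := dr.
by have [] := di.
Qed.

Lemma ccontinuousW y : ccontinuous y -> ccontinuous_closed y.
Proof. by move=> [? ?]; split; exact: continuous_subspaceT. Qed.

Lemma ae_equal_closed y z : ccontinuous_closed y -> ccontinuous_closed z ->
  ae_equal y z -> forall x, Iclosed R x -> y x = z x.
Proof.
move=> [yr yi] [zr zi] yz x Ix.
have := ae_eq_continuous yr zr (ae_equal_Re yz) Ix.
have := ae_eq_continuous yi zi (ae_equal_Im yz) Ix.
by case: (y x) (z x) => [? ?] [? ?] /= -> ->.
Qed.

Lemma L2_of_continuous y : ccontinuous y -> exists u : L2 R, ae_equal u y.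
Proof.
move=> [yr yi].
have sy : square_integrable y.
  split; first by split; apply: measurable_funTS; exact: continuous_measurable_fun.
  have c2 : continuous (fun x => complex.Re (y x) ^+ 2 + complex.Im (y x) ^+ 2).
    by move=> x; apply: cvgD; [apply: (cvgM (yr x) (yr x))|apply: (cvgM (yi x) (yi x))].
  have /integrableP[_] := continuous_integrable_I c2.
  apply: le_lt_trans; rewrite le_eqVlt; apply/orP; left; apply/eqP.
  apply: eq_integral => x _; rewrite /= normc_sqr ger0_norm//.
  by rewrite addr_ge0 ?sqr_ge0.
have yP : (y : R -> R[i]^o) \in sqint_pred by rewrite inE.
by exists (\pi_(L2 R) (SqInt yP)); exact: L2_reprE.
Qed.

Lemma weak_derivative_C1 u v y z : ae_equal u y -> ae_equal v z ->
  (forall x, cderiv y z x) -> ccontinuous z -> is_weak_derivative u v.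
Proof.
move=> uy vz dy [zr zi]; have [yr yi] := cderiv_continuous dy.
have [ur ui] := L2_measurable u; have [vr vi] := L2_measurable v.
have mc (f : R -> R) : continuous f -> measurable_fun I f.
  by move=> cf; apply: measurable_funTS; exact: continuous_measurable_fun.
apply/is_weak_derivativeP; split.
  apply: (weak_pair_ae (mc _ yr) ur (mc _ zr) vr).
  - exact: ae_equal_Re (ae_equal_sym uy).
  - exact: ae_equal_Re (ae_equal_sym vz).
  - by apply: weak_pair_C1 => // x; have [] := dy x.
apply: (weak_pair_ae (mc _ yi) ui (mc _ zi) vi).
- exact: ae_equal_Im (ae_equal_sym uy).
- exact: ae_equal_Im (ae_equal_sym vz).
- by apply: weak_pair_C1 => // x; have [] := dy x.
Qed.

Lemma Iclosed_points (a : R) : -1 < a < 1 ->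
  [/\ Iclosed R (- L), Iclosed R (L * a) & Iclosed R L].
Proof.
move=> /andP[a1 a2]; have p0 : 0 < L by rewrite divr_gt0// pi_gt0.
by rewrite /Iclosed/= !in_itv/=; split; apply/andP; split => //; nra.
Qed.

(** [y], [z], [t] represent [u] and its first two weak derivatives, and [y] itself is the continuous
    representative carrying the boundary conditions. *)
Lemma Hop_classical (a : R) u y z (t : R -> R[i]) : ae_equal u y ->
  (forall x, cderiv y z x) -> (forall x, cderiv z t x) -> ccontinuous t ->
  y (- L) = y (L * a) -> y (L * a) = y L ->
  op_dom (Hop a) u /\ ae_equal (Hop a u : L2 R) (fun x => - t x).
Proof.
move=> uy dy dz ct bc1 bc2.
have [v vz] := L2_of_continuous (cderiv_continuous dz).
have [w wt] := L2_of_continuous ct.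
have uv := weak_derivative_C1 uy vz dy (cderiv_continuous dz).
have vw := weak_derivative_C1 vz wt dz ct.
have [yr yi] := ccontinuousW (cderiv_continuous dy).
split; first split.
- by split; [exists v|rewrite (wderiv_eq uv); exists w].
- by exists y.
rewrite /= (wderiv_eq uv) (wderiv_eq vw).
apply: filterS2 (L2_oppE w) wt => x ow wt Ix.
by rewrite ow// wt.
Qed.

Lemma weak_derivative_primitive u v : is_weak_derivative u v ->
  exists y, [/\ ccontinuous_closed y, ae_equal u y &
    forall t, {in I, continuous (fun x => complex.Re (t x))} ->
      {in I, continuous (fun x => complex.Im (t x))} ->
      ae_equal v t -> forall x, I x -> cderiv y t x].
Proof.
move=> /is_weak_derivativeP[wr wi].
have [ur ui] := L2_integrable u; have [vr vi] := L2_integrable v.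
have [F [cF uF _ dF]] := weak_primitive ur vr wr.
have [G [cG uG _ dG]] := weak_primitive ui vi wi.
exists (fun x => Complex (F x) (G x)); split => //.
- by apply: filterS2 uF uG => x h1 h2 Ix; move: (h1 Ix) (h2 Ix); case: (u x) => ? ? /= -> ->.
- move=> t tr ti vt x Ix; split => /=.
    by apply: (dF (fun x => complex.Re (t x))) => //; exact: ae_equal_Re.
  by apply: (dG (fun x => complex.Im (t x))) => //; exact: ae_equal_Im.
Qed.

Lemma within_continuous_in (f : R -> R) :
  {within Iclosed R, continuous f} -> {in I, continuous f}.
Proof.
move=> cf.
have : {within I, continuous f} by apply: continuous_subspaceW cf; exact: subset_itv_oo_cc.
by rewrite continuous_open_subspace//; exact: interval_open.
Qed.

(** A bootstrap: u and u' have continuous representatives [y] and [z], being weakly differentiable;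
    the equation then gives u'' the continuous representative [- lambda * y - g]. Thus both
    derivatives exist at every point of [I]. The boundary conditions pass from [w] to [y] because
    continuous representatives coincide on the closed interval. *)
Lemma Hop_regular (a : R) (lambda : R[i]) u (g : R -> R[i]) : -1 < a < 1 ->
  op_dom (Hop a) u -> ccontinuous g ->
  ae_equal (op_shift (Hop a) lambda u : L2 R) g ->
  exists y z, [/\ ccontinuous_closed y, ccontinuous_closed z, ae_equal u y,
    (forall x, I x -> cderiv y z x /\ cderiv z (fun x => - lambda * y x - g x) x) &
    y (- L) = y (L * a) /\ y (L * a) = y L].
Proof.
move=> ha [[uH1 vH1] [w [[wr wi uw] bc1 bc2]]] [gr gi] Hug.
have [y [[yr yi] uy dy]] := weak_derivative_primitive (wderivP uH1).
have [z [[zr zi] vz dz]] := weak_derivative_primitive (wderivP vH1).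
exists y, z.
have yw := @ae_equal_closed y w (conj yr yi) (conj wr wi)
  (ae_equal_trans (ae_equal_sym uy) uw).
have [I1 I2 I3] := Iclosed_points ha.
have H : ae_equal (wderiv (wderiv u)) (fun x => - lambda * y x - g x).
  have := L2_scaleE lambda u.
  have := L2_oppE (wderiv (wderiv u)); have := L2_oppE (lambda *: u).
  have := L2_addE (- wderiv (wderiv u)) (- (lambda *: u)).
  move=> h1 h2 h3 h4.
  apply: filterS2 (filterI (filterI h1 h2) (filterI h3 h4)) (filterI Hug uy).
  move=> x [[{}h1 {}h2] [{}h3 {}h4]] [h5 h6] Ix.
  have := h5 Ix; rewrite /op_shift/= (h1 Ix) (h2 Ix) (h3 Ix) (h4 Ix) (h6 Ix) => <-.
  ring.
have cr : {within Iclosed R, continuous (fun x => complex.Re (- lambda * y x - g x))}.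
  rewrite (_ : (fun x => _) = (fun x => complex.Re (- lambda) * complex.Re (y x) -
     complex.Im (- lambda) * complex.Im (y x) + - complex.Re (g x))); last first.
    by apply/funext => x; rewrite cReD cReM; case: (g x).
  move=> x; apply: cvgD; last by apply: cvgN; exact: continuous_subspaceT.
  by apply: cvgB; (apply: cvgM; first exact: cvg_cst); [exact: yr|exact: yi].
have ci : {within Iclosed R, continuous (fun x => complex.Im (- lambda * y x - g x))}.
  rewrite (_ : (fun x => _) = (fun x => complex.Re (- lambda) * complex.Im (y x) +
     complex.Im (- lambda) * complex.Re (y x) + - complex.Im (g x))); last first.
    by apply/funext => x; rewrite cImD cImM; case: (g x).
  move=> x; apply: cvgD; last by apply: cvgN; exact: continuous_subspaceT.
  by apply: cvgD; (apply: cvgM; first exact: cvg_cst); [exact: yi|exact: yr].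
split => //.
- by move=> x Ix; split; [apply: dy|apply: dz] => //; exact: within_continuous_in.
- by rewrite !yw.
Qed.

End Regularity.

(** * Explicit solutions of the eigenvalue equation *)

Section ComplexODE.
Context {R : realType}.
Local Notation I := (Iopen R).
Local Notation L := (pi / 2 : R).
Implicit Types (y z : R -> R[i]) (k : R[i]).

Lemma cderiv_eq y z1 z2 (x : R) : z1 x = z2 x -> cderiv y z1 x -> cderiv y z2 x.
Proof. by rewrite /cderiv => ->. Qed.

Lemma cderiv_cst (c : R[i]) (x : R) : cderiv (fun=> c) (fun=> 0) x.
Proof. by split; exact: is_derive_cst. Qed.

Lemma cderiv_id (x : R) : cderiv (fun t => t%:C%C) (fun=> 1) x.
Proof. by split => /=; [exact: is_derive_id|exact: is_derive_cst]. Qed.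

Lemma cderivD y1 y2 z1 z2 (x : R) : cderiv y1 z1 x -> cderiv y2 z2 x ->
  cderiv (fun t => y1 t + y2 t) (fun t => z1 t + z2 t) x.
Proof.
move=> [r1 i1] [r2 i2]; split.
  under eq_fun do rewrite cReD; rewrite cReD; exact: is_deriveD.
under eq_fun do rewrite cImD; rewrite cImD; exact: is_deriveD.
Qed.

Lemma cderivM y1 y2 z1 z2 (x : R) : cderiv y1 z1 x -> cderiv y2 z2 x ->
  cderiv (fun t => y1 t * y2 t) (fun t => z1 t * y2 t + y1 t * z2 t) x.
Proof.
move=> [r1 i1] [r2 i2]; split.
  under eq_fun do rewrite cReM.
  apply: (is_derive_eq (is_deriveB (is_deriveM r1 r2) (is_deriveM i1 i2))).
  by rewrite cReD !cReM /GRing.scale /=; ring.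
under eq_fun do rewrite cImM.
apply: (is_derive_eq (is_deriveD (is_deriveM r1 i2) (is_deriveM i1 r2))).
by rewrite cImD !cImM /GRing.scale /=; ring.
Qed.

Lemma cderivZ (c : R[i]) y z (x : R) : cderiv y z x ->
  cderiv (fun t => c * y t) (fun t => c * z t) x.
Proof.
move=> dy; apply: cderiv_eq (cderivM (cderiv_cst c x) dy).
by rewrite mul0r add0r.
Qed.

Lemma ccontinuous_closed_cst (c : R[i]) : ccontinuous_closed (fun=> c).
Proof. by apply: ccontinuousW; split; exact: cst_continuous. Qed.

Lemma ccontinuous_closedD y z : ccontinuous_closed y -> ccontinuous_closed z ->
  ccontinuous_closed (fun x => y x + z x).
Proof.
move=> [yr yi] [zr zi]; split.
  under eq_fun do rewrite cReD.
  by move=> x; apply: cvgD; [exact: yr|exact: zr].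
under eq_fun do rewrite cImD.
by move=> x; apply: cvgD; [exact: yi|exact: zi].
Qed.

Lemma ccontinuous_closedM y z : ccontinuous_closed y -> ccontinuous_closed z ->
  ccontinuous_closed (fun x => y x * z x).
Proof.
move=> [yr yi] [zr zi]; split.
  under eq_fun do rewrite cReM.
  by move=> x; apply: cvgB; apply: cvgM; [exact: yr|exact: zr|exact: yi|exact: zi].
under eq_fun do rewrite cImM.
by move=> x; apply: cvgD; apply: cvgM; [exact: yr|exact: zi|exact: yi|exact: zr].
Qed.

Lemma ccontinuousM y z : ccontinuous y -> ccontinuous z ->
  ccontinuous (fun x => y x * z x).
Proof.
move=> [yr yi] [zr zi]; split.
  under eq_fun do rewrite cReM.
  by move=> x; apply: cvgB; apply: cvgM; [exact: yr|exact: zr|exact: yi|exact: zi].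
under eq_fun do rewrite cImM.
by move=> x; apply: cvgD; apply: cvgM; [exact: yr|exact: zi|exact: yi|exact: zr].
Qed.

Lemma ccontinuousD y z : ccontinuous y -> ccontinuous z ->
  ccontinuous (fun x => y x + z x).
Proof.
move=> [yr yi] [zr zi]; split.
  under eq_fun do rewrite cReD.
  by move=> x; apply: cvgD; [exact: yr|exact: zr].
under eq_fun do rewrite cImD.
by move=> x; apply: cvgD; [exact: yi|exact: zi].
Qed.

Lemma ccontinuous_cst (c : R[i]) : ccontinuous (fun=> c).
Proof. by split; exact: cst_continuous. Qed.

Lemma is_derive0_cst_closed (f : R -> R) : {within Iclosed R, continuous f} ->
  (forall x : R, I x -> is_derive x 1 f 0) -> forall x, Iclosed R x -> f x = f (- L).
Proof.
move=> cf df x; rewrite /Iclosed/= in_itv/= => /andP[x1 x2].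
have [] := @MVT_segment _ f (fun=> 0) (- L) x x1.
- move=> y; rewrite in_itv/= => /andP[y1 y2]; apply: df.
  by rewrite /Iopen/= in_itv/= y1 (lt_le_trans y2).
- by apply: continuous_subspaceW cf; apply: subset_itvl; rewrite bnd_simp.
by move=> c _ /eqP; rewrite mul0r subr_eq0 => /eqP.
Qed.

Lemma cderiv0_cst y : ccontinuous_closed y ->
  (forall x, I x -> cderiv y (fun=> 0) x) -> forall x, Iclosed R x -> y x = y (- L).
Proof.
move=> [yr yi] dy x Ix.
have := is_derive0_cst_closed yr (fun t It => (dy t It).1) Ix.
have := is_derive0_cst_closed yi (fun t It => (dy t It).2) Ix.
by case: (y x) (y (- L)) => [? ?] [? ?] /= -> ->.
Qed.

(** The function e^{ikx}, for complex k, by real and imaginary parts. *)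
Definition cexpi k (x : R) : R[i] :=
  Complex (expR (- complex.Im k * x) * cos (complex.Re k * x))
          (expR (- complex.Im k * x) * sin (complex.Re k * x)).

Lemma cderiv_cexpi k (x : R) : cderiv (cexpi k) (fun t => 'i%C * k * cexpi k t) x.
Proof.
case: k => p q.
have lin (c : R) : is_derive x 1 (fun t => c * t) c.
  by apply: (is_derive_eq (is_deriveM (is_derive_cst c x 1) (is_derive_id x 1)));
    rewrite /GRing.scale /=; ring.
have de := @is_derive1_comp _ expR _ x _ _ (is_derive_expR _) (lin (- q)).
have dc := @is_derive1_comp _ cos _ x _ _ (is_derive_cos _) (lin p).
have ds := @is_derive1_comp _ sin _ x _ _ (is_derive_sin _) (lin p).
split.
  apply: (is_derive_eq (is_deriveM de dc)).
  by rewrite !cReM !cImM /GRing.scale /=; ring.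
apply: (is_derive_eq (is_deriveM de ds)).
by rewrite !cImM !cReM /GRing.scale /=; ring.
Qed.

Lemma cexpiN k (x : R) : cexpi k (- x) = cexpi (- k) x.
Proof. by case: k => p q; rewrite /cexpi /= !mulrN !mulNr. Qed.

Lemma cexpiNM k (x : R) : cexpi k x * cexpi (- k) x = 1.
Proof.
case: k => p q; rewrite /cexpi /= !mulNr cosN sinN opprK.
have := expRxMexpNx_1 (q * x); have := cos2Dsin2 (p * x).
set a := expR _; set b := expR _; set c := cos _; set s := sin _ => h1 h2.
apply/eqP; rewrite eq_complex; apply/andP; split; apply/eqP; rewrite ?cReM ?cImM /=.
  by transitivity ((a * b) * (c ^+ 2 + s ^+ 2)); [ring|rewrite h1 h2 mulr1].
by ring.
Qed.

Lemma cexpi_continuous k : ccontinuous (cexpi k).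
Proof. by apply: cderiv_continuous => x; exact: cderiv_cexpi. Qed.

End ComplexODE.

Section SolveODE.
Context {R : realType}.
Local Notation I := (Iopen R).
Local Notation L := (pi / 2 : R).
Local Notation "x %:C" := (x%:C)%C.
Implicit Types (y z : R -> R[i]) (k : R[i]).

(* For [j = k] and [j = - k], the function [e ^{ijx} (y' - ijy)] is constant. *)
Lemma ode_exp k y z : k != 0 -> ccontinuous_closed y -> ccontinuous_closed z ->
  (forall x, I x -> cderiv y z x /\ cderiv z (fun t => - k ^+ 2 * y t) x) ->
  exists P Q, forall x, Iclosed R x -> y x = P * cexpi k x + Q * cexpi (- k) x.
Proof.
move=> k0 cy cz ode.
have i0 : ('i%C : R[i]) != 0 by rewrite eq_complex /= oner_eq0 andbF.
have i2 : ('i%C : R[i]) ^+ 2 = -1 by rewrite sqr_i.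
have cst (j : R[i]) : j ^+ 2 = k ^+ 2 -> forall x, Iclosed R x ->
    cexpi j x * (z x + - ('i%C * j) * y x) =
    cexpi j (- L) * (z (- L) + - ('i%C * j) * y (- L)).
  move=> jk; apply: cderiv0_cst.
    apply: ccontinuous_closedM; first exact: ccontinuousW (cexpi_continuous j).
    apply: ccontinuous_closedD => //; apply: ccontinuous_closedM => //.
    exact: ccontinuous_closed_cst.
  move=> x Ix; have [dy dz] := ode x Ix.
  apply: cderiv_eq (cderivM (cderiv_cexpi j x) (cderivD dz (cderivZ (- ('i%C * j)) dy))).
  rewrite -jk /=.
  transitivity (- (1 + 'i%C ^+ 2) * (j ^+ 2 * cexpi j x * y x)); first by ring.
  by rewrite i2 subrr oppr0 mul0r.
(* With C_j the constant attached to j, the combination e^{ikx} C_{-k} - e^{-ikx} C_k eliminates y'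
   and equals 2ik y; hence P = C_{-k} / (2ik) and Q = - C_k / (2ik). *)
exists ((cexpi (- k) (- L) * (z (- L) + - ('i%C * - k) * y (- L))) / (2 * 'i%C * k)).
exists (- (cexpi k (- L) * (z (- L) + - ('i%C * k) * y (- L))) / (2 * 'i%C * k)).
move=> x Ix.
rewrite -(cst _ _ x Ix) ?sqrrN// -(cst _ (erefl _) x Ix).
have EE := cexpiNM k x.
have d0 : 2 * 'i%C * k != 0 by rewrite !mulf_neq0 ?pnatr_eq0.
apply: (mulIf d0).
transitivity ((cexpi k x * cexpi (- k) x) * (2 * 'i%C * k * y x)).
  by rewrite EE mul1r mulrC.
by field; rewrite k0.
Qed.

(** The source f solves the homogeneous equation, so a particular solution x w is sought with w of
    the same form; (x w)'' = x w'' + 2 w' reduces this to 2 w' = - f. Subtracting it leaves the case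
    of [ode_exp]. *)
Lemma ode_exp_inhomogeneous k y z (P0 Q0 : R[i]) : k != 0 ->
  ccontinuous_closed y -> ccontinuous_closed z ->
  (forall x, I x -> cderiv y z x /\
     cderiv z (fun t => - k ^+ 2 * y t - (P0 * cexpi k t + Q0 * cexpi (- k) t)) x) ->
  exists P Q, forall x, Iclosed R x -> y x = P * cexpi k x + Q * cexpi (- k) x +
    x%:C * (2 * 'i%C * k)^-1 * (- P0 * cexpi k x + Q0 * cexpi (- k) x).
Proof.
move=> k0 cy cz ode.
have i0 : ('i%C : R[i]) != 0 by rewrite eq_complex /= oner_eq0 andbF.
have i2 : ('i%C : R[i]) ^+ 2 = -1 by rewrite sqr_i.
have d0 : 2 * 'i%C * k != 0 by rewrite !mulf_neq0 ?pnatr_eq0.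
pose m := (2 * 'i%C * k)^-1.
pose yp x := x%:C * (m * - P0 * cexpi k x + m * Q0 * cexpi (- k) x).
pose s x := m * - P0 * ('i%C * k * cexpi k x) + m * Q0 * ('i%C * - k * cexpi (- k) x).
pose zp x := 1 * (m * - P0 * cexpi k x + m * Q0 * cexpi (- k) x) + x%:C * s x.
have dw (x : R) : cderiv (fun x => m * - P0 * cexpi k x + m * Q0 * cexpi (- k) x) s x.
  by apply: cderivD; apply: cderivZ; exact: cderiv_cexpi.
have dyp x : cderiv yp zp x by exact: cderivM (cderiv_id x) (dw x).
have ds x : cderiv s (fun x => - k ^+ 2 * (m * - P0 * cexpi k x + m * Q0 * cexpi (- k) x)) x.
  apply: cderiv_eq (cderivD
     (cderivZ (m * - P0) (cderivZ ('i%C * k) (cderiv_cexpi k x)))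
     (cderivZ (m * Q0) (cderivZ ('i%C * - k) (cderiv_cexpi (- k) x)))).
  transitivity ('i%C ^+ 2 * (k ^+ 2 * (m * - P0 * cexpi k x + m * Q0 * cexpi (- k) x))).
    by ring.
  by rewrite i2; ring.
have dzp x : cderiv zp (fun x => - k ^+ 2 * yp x - (P0 * cexpi k x + Q0 * cexpi (- k) x)) x.
  apply: cderiv_eq (cderivD (cderivZ 1 (dw x)) (cderivM (cderiv_id x) (ds x))).
  by rewrite /yp /s /m; field; rewrite k0.
have cyp : ccontinuous_closed yp by apply: ccontinuousW; exact: cderiv_continuous dyp.
have czp : ccontinuous_closed zp by apply: ccontinuousW; exact: cderiv_continuous dzp.
have cN (f : R -> R[i]) : ccontinuous_closed f -> ccontinuous_closed (fun x => -1 * f x).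
  by move=> cf; apply: ccontinuous_closedM => //; exact: ccontinuous_closed_cst.
have [|P [Q PQ]] := ode_exp k0 (ccontinuous_closedD cy (cN _ cyp))
    (ccontinuous_closedD cz (cN _ czp)).
  move=> x Ix; have [dy dz] := ode x Ix; split.
    by apply: cderivD => //; exact: cderivZ.
  apply: cderiv_eq (cderivD dz (cderivZ (-1) (dzp x))); ring.
exists P, Q => x Ix; rewrite -PQ// /yp -/m; ring.
Qed.

(** Two successive first integrals: z + A0 x is a constant B, and then y - B x + A0 x^2 / 2 is
    constant. *)
Lemma ode_affine y z (A0 : R[i]) :
  ccontinuous_closed y -> ccontinuous_closed z ->
  (forall x, I x -> cderiv y z x /\ cderiv z (fun=> - A0) x) ->
  exists A B, forall x, Iclosed R x -> y x = A + x%:C * B - A0 * x%:C ^+ 2 / 2.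
Proof.
move=> cy cz ode.
have ci : ccontinuous_closed (fun x : R => x%:C).
  by apply: ccontinuousW; exact: cderiv_continuous cderiv_id.
have cZ (c : R[i]) f : ccontinuous_closed f -> ccontinuous_closed (fun x : R => c * f x).
  by move=> cf; apply: ccontinuous_closedM => //; exact: ccontinuous_closed_cst.
have zE x : Iclosed R x -> z x + A0 * x%:C = z (- L) + A0 * (- L)%:C.
  apply: (@cderiv0_cst _ (fun x => z x + A0 * x%:C)).
    by apply: ccontinuous_closedD => //; exact: cZ.
  move=> t It; have [_ dz] := ode t It.
  by apply: cderiv_eq (cderivD dz (cderivZ A0 (cderiv_id t))); rewrite mulr1 addNr.
pose B := z (- L) + A0 * (- L)%:C.
pose w x := y x + ((- B) * x%:C + (A0 / 2) * (x%:C * x%:C)).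
have wE x : Iclosed R x -> w x = w (- L).
  apply: (@cderiv0_cst _ w).
    apply: ccontinuous_closedD => //; apply: ccontinuous_closedD; first exact: cZ.
    by apply: cZ; exact: ccontinuous_closedM.
  move=> t It; have [dy _] := ode t It.
  apply: cderiv_eq (cderivD dy (cderivD (cderivZ (- B) (cderiv_id t))
    (cderivZ (A0 / 2) (cderivM (cderiv_id t) (cderiv_id t))))).
  have := zE t (subset_itv_oo_cc It); rewrite -/B => <-.
  by field.
exists (w (- L)), B => x Ix; rewrite -(wE x Ix) /w; by field.
Qed.

End SolveODE.

(** * Resonant frequencies and rationality of the interior point *)

Section Frequencies.
Context {R : realType}.
Local Notation L := (pi / 2 : R).

(** Subtracting floor(x / pi) times pi moves x into [0, pi[, where the sine is positive except at
    0. *)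
Lemma sin_eq0_pi (x : R) : sin x = 0 -> exists n : int, x = n%:~R * pi.
Proof.
have p0 := pi_gt0 R.
have nE (y : R) (j : int) : sin (y + j%:~R * pi) = 0 -> sin y = 0.
  have alt (m : nat) (t : R) : sin (t + m%:R * pi) = (-1) ^+ m * sin t.
    by rewrite mulr_natl (alternatingn (@sinDpi R)).
  case: j => m.
    rewrite -[(Posz m)%:~R]/(m%:R : R) alt => /eqP.
    by rewrite mulf_eq0 signr_eq0 => /eqP.
  rewrite NegzE mulrNz mulNr => s0.
  by rewrite -(subrK (m.+1%:R * pi) y) alt s0 mulr0.
move=> sx; pose n := Num.floor (x / pi).
have /andP[n1 n2] : n%:~R <= x / pi < (n + 1)%:~R by exact: floor_itv.
move: n1 n2; rewrite ler_pdivlMr// ltr_pdivrMr// intrD mulrDl mul1r => n1 n2.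
exists n; apply/eqP; rewrite -subr_eq0; apply: contraT => ne.
have : 0 < sin (x - n%:~R * pi).
  apply: sin_gt0_pi; rewrite lt_neqAle eq_sym ne subr_ge0 n1/=.
  by rewrite ltrBlDr addrC.
by rewrite (@nE (x - n%:~R * pi) n) ?ltxx// subrK.
Qed.

(** The exponential is 1 or -1: its vanishing imaginary part gives sin = 0, and its modulus exp(- Im
    k x) = 1 gives Im k = 0. *)
Lemma cexpi_sqr1 (k : R[i]) (x : R) : 0 < x -> cexpi k x ^+ 2 = 1 ->
  complex.Im k = 0 /\ exists n : int, complex.Re k * x = n%:~R * pi.
Proof.
move=> x0 /eqP; rewrite sqrf_eq1 => e1.
have {e1} [n1 s0] : complex.Re (cexpi k x) ^+ 2 = 1 /\ complex.Im (cexpi k x) = 0.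
  by case/orP : e1 => /eqP ->/=; rewrite ?oppr0 ?sqrrN expr1n.
move: n1 s0; rewrite /cexpi/= => n1 /eqP; rewrite mulf_eq0 gt_eqF ?expR_gt0//=.
move=> /eqP s0; split; last exact: sin_eq0_pi.
have := cos2Dsin2 (complex.Re k * x); rewrite s0 expr0n addr0 => c2.
move: n1; rewrite exprMn c2 mulr1 => /eqP.
rewrite sqrf_eq1 => /orP[/eqP/(congr1 (@ln R))|/eqP n1]; last first.
  by have := expR_gt0 (- complex.Im k * x); rewrite n1 oppr_gt0 ltr10.
rewrite expRK ln1 => /eqP; rewrite mulf_eq0 (gt_eqF x0) orbF oppr_eq0.
by move/eqP.
Qed.

(** Dividing kLa = m pi by kL = n pi gives a = m / n. As [cexpi_sqr1] takes a positive argument, a =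
    0 is set apart and a < 0 is treated by passing to -k and -a. *)
Lemma cexpi_rational (k : R[i]) (a : R) : k != 0 ->
  cexpi k L ^+ 2 = 1 -> cexpi k (L * a) = cexpi k L -> rational a.
Proof.
move=> k0 e1 ea; have [->|a0] := eqVneq a 0; first by exists 0; rewrite ?rmorph0.
have L0 : 0 < L by rewrite divr_gt0// pi_gt0.
have [k1 [n nE]] := cexpi_sqr1 L0 e1.
have {}k0 : complex.Re k != 0.
  by apply: contraNneq k0; case: k k1 {e1 ea nE} => p q /= -> ->.
have n0 : n%:~R != 0 :> R.
  apply: contraTneq isT => n0; have := mulf_neq0 k0 (lt0r_neq0 L0).
  by rewrite nE n0 mul0r eqxx.
have [m mE] : exists m : int, complex.Re k * (L * a) = m%:~R * pi.
  have [ap|an] := ltP 0 a.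
    by have [] := @cexpi_sqr1 k (L * a) (mulr_gt0 L0 ap) _; rewrite ?ea.
  have an' : 0 < L * - a by rewrite mulr_gt0// oppr_gt0 lt_neqAle a0.
  have [|_ [m mE]] := @cexpi_sqr1 (- k) (L * - a) an'.
    by rewrite -cexpiN mulrN opprK ea.
  exists m; rewrite -mE mulrN; case: (k) => p q /=; by rewrite mulrNN.
have p0 : pi != 0 :> R by rewrite gt_eqF// pi_gt0.
have aE : a = m%:~R / n%:~R.
  apply: (mulIf n0); apply: (mulIf p0); rewrite divfK// -mE -mulrA -nE; ring.
by rewrite aE; exists (m%:~R / n%:~R) => //; rewrite fmorph_div/= !ratr_int.
Qed.

End Frequencies.

(** * Boundary conditions and multiplicities *)

Section OperatorAlgebra.
Context {K : fieldType} {X : lmodType K}.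

(** If S^{n+1} u = 0 then S u lies in ker S^n, hence in ker S by induction, and the last hypothesis
    gives S u = 0. The root space is thus the line ker S. *)
Lemma alg_simple_ker_line (T : operator X) (lambda : K) (u0 : X) : u0 != 0 ->
  (forall u, op_ker (op_shift T lambda) u <-> exists c, u = c *: u0) ->
  (forall u, op_dom T u -> op_ker (op_shift T lambda) (op_shift T lambda u) ->
     op_shift T lambda u = 0) ->
  alg_simple T lambda.
Proof.
move=> u0n kerE ker2; set S := op_shift T lambda.
have powE n u : op_ker (op_pow S n.+1) u -> op_ker S u.
  elim: n u => [|n IH] u [[du dSu] Su0]; first by split.
  by split=> //; apply: ker2 => //; apply: IH; split.
exists (fun=> u0); split.
  move=> c; rewrite big_ord1 => /eqP; rewrite scaler_eq0 (negPf u0n) orbF.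
  by move=> /eqP c0 i; rewrite ord1.
apply/seteqP; split=> u /=.
  case=> -[//|n] _ /powE /kerE [c ->].
  by exists (fun=> c); rewrite big_ord1.
case=> c; rewrite big_ord1 => uE; exists 1%N => //=.
have [du Su] : op_ker S u by apply/kerE; exists (c ord0).
by split.
Qed.

End OperatorAlgebra.

Section BoundaryAlgebra.
Context {F : numFieldType}.
Variables (e em g gm P Q : F).
Hypotheses (eK : e * em = 1) (gK : g * gm = 1).
Hypotheses (bc1 : P * em + Q * e = P * g + Q * gm)
           (bc2 : P * g + Q * gm = P * e + Q * em).

(* Values at [L] and [La] of [e ^{ikx}] and [e ^{-ikx}] are [e], [em] and [g], [gm]. *)
Lemma boundary_ratio : (e ^+ 2 = 1 -> g <> e) ->
  P = Q * (if e ^+ 2 == 1 then e * gm else 1).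
Proof.
move=> ge; have e0 : e != 0 by apply: contra_eq_neq eK => ->; rewrite mul0r eq_sym oner_eq0.
have g0 : g != 0 by apply: contra_eq_neq gK => ->; rewrite mul0r eq_sym oner_eq0.
case: eqP => [e1|/eqP e1].
  have eme : em = e by apply: (mulfI e0); rewrite eK -expr2.
  (* With [em = e] and [e ^+ 2 = 1], this is the second condition multiplied by [g]. *)
  have /eqP : (P * g - Q * e) * (g - e) = 0.
    have -> : (P * g - Q * e) * (g - e) =
      (P * g + Q * gm - (P * e + Q * em)) * g + Q * (1 - g * gm) + Q * (em - e) * g
        + Q * (e ^+ 2 - 1) by ring.
    by rewrite bc2 subrr gK eme !subrr e1 subrr; ring.
  rewrite mulf_eq0 !subr_eq0 => /orP[/eqP h|/eqP]; last by move/ge: e1.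
  by apply: (mulIf g0); rewrite h -mulrA -mulrA [gm * g]mulrC gK mulr1.
rewrite mulr1; apply/eqP; rewrite -subr_eq0.
(* Equality of the values at the two endpoints. *)
have /eqP : (P - Q) * (em - e) = 0.
  transitivity (P * em + Q * e - (P * e + Q * em)); first by ring.
  by rewrite bc1 bc2 subrr.
rewrite mulf_eq0 => /orP[//|/eqP/subr0_eq eme].
by move: e1; rewrite expr2 -{2}eme eK eqxx.
Qed.

(* [P', Q'] are the free coefficients of a solution of [(H - k ^ 2) y = f], where [f] has
   coefficients [P, Q], and [l = L / (2ik)]. *)
Lemma boundary_resonance (P' Q' l a : F) : (e ^+ 2 = 1 -> g <> e) ->
  l != 0 -> a != 1 -> a != -1 ->
  P' * em + Q' * e - l * (- P * em + Q * e) =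
    P' * g + Q' * gm + l * a * (- P * g + Q * gm) ->
  P' * g + Q' * gm + l * a * (- P * g + Q * gm) =
    P' * e + Q' * em + l * (- P * e + Q * em) ->
  P = 0 /\ Q = 0.
Proof.
move=> ge l0 a1 am1 h1 h2; have PQ := boundary_ratio ge.
have e0 : e != 0 by apply: contra_eq_neq eK => ->; rewrite mul0r eq_sym oner_eq0.
have g0 : g != 0 by apply: contra_eq_neq gK => ->; rewrite mul0r eq_sym oner_eq0.
have h3 := etrans h1 h2.
move: PQ; case: eqP => [e1|/eqP e1] PQ.
  have eme : em = e by apply: (mulfI e0); rewrite eK -expr2.
  (* When [em = e], the coefficients [P'] and [Q'] cancel between the two endpoints and only the
     resonant term remains. *)
  have /eqP : 2 * (l * e * (Q - P)) = 0.
    rewrite eme in h3.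
    transitivity ((P' * e + Q' * e + l * (- P * e + Q * e)) -
      (P' * e + Q' * e - l * (- P * e + Q * e))); first by ring.
    by rewrite h3 subrr.
  rewrite !mulf_eq0 pnatr_eq0 (negPf l0) (negPf e0)/= subr_eq0 => /eqP QP.
  have /eqP : Q * (g - e) = 0.
    by rewrite mulrBr {1}QP PQ -mulrA -mulrA [gm * g]mulrC gK mulr1 subrr.
  rewrite mulf_eq0 subr_eq0 => /orP[/eqP Q0|/eqP]; last by move/ge: e1.
  by rewrite -QP Q0.
move: PQ; rewrite mulr1 => PQ; have eme : em != e.
  by apply: contra_neq e1 => eme; rewrite expr2 -{2}eme.
have PQ' : P' = Q'.
  apply/eqP; rewrite -subr_eq0.
  have /eqP : (P' - Q') * (em - e) = 0.
    transitivity ((P' * em + Q' * e - l * (- P * em + Q * e)) -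
       (P' * e + Q' * em + l * (- P * e + Q * em))); first by rewrite PQ; ring.
    by rewrite h3 subrr.
  by rewrite mulf_eq0 !subr_eq0 (negPf eme) orbF.
suff Q0 : Q = 0 by rewrite PQ Q0.
apply/eqP; apply: contraT => Q0.
have sum : g + gm = e + em.
  by apply: (mulfI Q0); move: bc2; rewrite PQ -!mulrDr.
have /eqP prod : l * Q * (a * (gm - g) - (em - e)) = 0.
  transitivity ((P' * g + Q' * gm + l * a * (- P * g + Q * gm)) -
    (P' * e + Q' * em + l * (- P * e + Q * em)) - Q' * (g + gm - (e + em))).
    by rewrite PQ PQ'; ring.
  by rewrite h2 sum !subrr mulr0 subrr.
move: prod; rewrite !mulf_eq0 (negPf l0) (negPf Q0) /= subr_eq0 => /eqP prod.
(* The pairs [g, gm] and [e, em] have the same sum and product, so they coincide up to order; the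
   relation a (gm - g) = em - e then gives a = 1 or a = -1. *)
have /eqP : (g - e) * (1 - em * gm) = 0.
  transitivity (g + gm - (e + em) + (1 - g * gm) * em - (1 - e * em) * gm); first by ring.
  by rewrite sum gK eK !subrr; ring.
rewrite mulf_eq0 subr_eq0 => /orP[/eqP gE|].
  have gmE : gm = em by apply: (mulfI e0); rewrite -{1}gE gK eK.
  have /eqP : (a - 1) * (em - e) = 0.
    by rewrite mulrBl mul1r; move: prod; rewrite gE gmE => ->; rewrite subrr.
  by rewrite mulf_eq0 !subr_eq0 (negPf a1) (negPf eme).
rewrite subr_eq0 eq_sym => /eqP emgm.
have gmE : gm = e by rewrite -[gm]mul1r -eK -mulrA emgm mulr1.
have gE : g = em by rewrite -[g]mulr1 -emgm mulrCA gK mulr1.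
have /eqP : (a + 1) * (e - em) = 0.
  by rewrite mulrDl mul1r; move: prod; rewrite gE gmE => ->; ring.
by rewrite mulf_eq0 addr_eq0 (negPf am1) subr_eq0 eq_sym (negPf eme).
Qed.

End BoundaryAlgebra.

(** * Kernels of the shifted operator and of its square *)

Section Spectrum.
Context {R : realType}.
Local Notation I := (Iopen R).
Local Notation L := (pi / 2 : R).
Local Notation "x %:C" := (x%:C)%C.
Variable a : R.
Hypothesis ha : -1 < a < 1.
Implicit Types (u : L2 R) (k lambda P Q : R[i]).
Local Notation H := (Hop a).

Definition expsum k P Q (x : R) : R[i] := P * cexpi k x + Q * cexpi (- k) x.

Definition boundary (y : R -> R[i]) : Prop :=
  y (- L) = y (L * a) /\ y (L * a) = y L.

Lemma expsum_continuous k P Q : ccontinuous (expsum k P Q).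
Proof.
by apply: ccontinuousD; apply: ccontinuousM;
  first [exact: ccontinuous_cst|exact: cexpi_continuous].
Qed.

Lemma op_shift_ker lambda u y z (t : R -> R[i]) : ae_equal u y ->
  (forall x, cderiv y z x) -> (forall x, cderiv z t x) -> ccontinuous t ->
  (forall x, t x = - lambda * y x) -> boundary y ->
  op_ker (op_shift H lambda) u.
Proof.
move=> uy dy dz ct ty [bc1 bc2].
have [du Hu] := Hop_classical uy dy dz ct bc1 bc2.
split=> //; apply: L2_ext.
have h := L2_addE (H u) (- (lambda *: u)).
apply: filterS2 (filterI (filterI h L2_zeroE)
  (filterI (L2_oppE (lambda *: u)) (L2_scaleE lambda u))) (filterI Hu uy).
move=> x [[h1 h2] [h3 h4]] [h5 h6] Ix.
rewrite (h2 Ix) [LHS](h1 Ix) (h3 Ix) (h4 Ix) [X in X + _](h5 Ix) (h6 Ix) ty.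
by ring.
Qed.

Lemma expsum_ker k P Q u : ae_equal u (expsum k P Q) -> boundary (expsum k P Q) ->
  op_ker (op_shift H (k ^+ 2)) u.
Proof.
move=> uE bc.
pose z x := P * ('i%C * k * cexpi k x) + Q * ('i%C * - k * cexpi (- k) x).
apply: (@op_shift_ker _ _ _ z (fun x => - k ^+ 2 * expsum k P Q x) uE) => //.
- by move=> x; apply: cderivD; apply: cderivZ; exact: cderiv_cexpi.
- move=> x; apply: cderiv_eq (cderivD
    (cderivZ P (cderivZ ('i%C * k) (cderiv_cexpi k x)))
    (cderivZ Q (cderivZ ('i%C * - k) (cderiv_cexpi (- k) x)))).
  transitivity ('i%C ^+ 2 * (k ^+ 2 * expsum k P Q x)); first by rewrite /expsum; ring.
  by rewrite sqr_i; ring.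
- by apply: ccontinuousM; [exact: ccontinuous_cst|exact: expsum_continuous].
Qed.

Lemma ae_equal_on_closed u (y z : R -> R[i]) : ae_equal u y ->
  (forall x, Iclosed R x -> y x = z x) -> ae_equal u z.
Proof.
by move=> + yz; apply: filterS => x uy Ix; rewrite uy// yz//; exact: subset_itv_oo_cc Ix.
Qed.

Lemma boundary_on_closed (y z : R -> R[i]) :
  (forall x, Iclosed R x -> y x = z x) -> boundary y -> boundary z.
Proof.
by move=> yz; have [? ? ?] := Iclosed_points ha; rewrite /boundary !yz.
Qed.

Lemma ker_expsum k u : k != 0 -> op_ker (op_shift H (k ^+ 2)) u ->
  exists P Q, ae_equal u (expsum k P Q) /\ boundary (expsum k P Q).
Proof.
move=> k0 [du Hu].
have Hu0 : ae_equal (op_shift H (k ^+ 2) u : L2 R) (fun=> 0) by rewrite Hu; exact: L2_zeroE.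
have [y [z [cy cz uy ode bc]]] := Hop_regular ha du (ccontinuous_cst 0) Hu0.
have [|P [Q PQ]] := ode_exp k0 cy cz.
  move=> x Ix; have [dy dz] := ode x Ix; split=> //.
  by apply: cderiv_eq dz; rewrite subr0.
exists P, Q; split; first exact: ae_equal_on_closed uy PQ.
exact: boundary_on_closed PQ bc.
Qed.

(** An affine function with equal values at -L and L has slope zero. *)
Lemma ker_cst u : op_ker (op_shift H 0) u <-> exists A, ae_equal u (fun=> A).
Proof.
split=> [[du Hu]|[A uA]]; last first.
  apply: (@op_shift_ker _ _ _ (fun=> 0) (fun=> 0) uA) => //.
  - exact: cderiv_cst.
  - exact: cderiv_cst.
  - exact: ccontinuous_cst.
  - by move=> x; rewrite oppr0 mul0r.
have Hu0 : ae_equal (op_shift H 0 u : L2 R) (fun=> 0) by rewrite Hu; exact: L2_zeroE.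
have [y [z [cy cz uy ode [bc1 bc2]]]] := Hop_regular ha du (ccontinuous_cst 0) Hu0.
have [|A [B AB]] := @ode_affine _ y z 0 cy cz.
  move=> x Ix; have [dy dz] := ode x Ix; split=> //.
  by apply: cderiv_eq dz; rewrite !oppr0 mul0r addr0.
have [I1 _ I3] := Iclosed_points ha.
have B0 : B = 0.
  have /eqP := etrans bc1 bc2; rewrite !AB// -subr_eq0 rmorphN /=.
  rewrite (_ : _ - _ = - (2 * L%:C * B)); last by ring.
  rewrite oppr_eq0 !mulf_eq0 pnatr_eq0/= => /orP[|/eqP//].
  by rewrite fmorph_eq0 gt_eqF// divr_gt0// pi_gt0.
exists A; apply: ae_equal_on_closed uy _ => x Ix.
by rewrite AB// B0 !mul0r mulr0 subr0 addr0.
Qed.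

(** Here y = A' + B x - A x^2 / 2: the endpoints give B = 0, and the interior point gives A L^2 (1 -
    a^2) / 2 = 0, so A = 0 because |a| < 1. *)
Lemma ker2_cst u : op_dom H u -> op_ker (op_shift H 0) (op_shift H 0 u) ->
  op_shift H 0 u = 0.
Proof.
move=> du /ker_cst [A HA].
have [y [z [cy cz uy ode [bc1 bc2]]]] := Hop_regular ha du (ccontinuous_cst A) HA.
have [|A' [B AB]] := @ode_affine _ y z A cy cz.
  move=> x Ix; have [dy dz] := ode x Ix; split=> //.
  by apply: cderiv_eq dz; rewrite oppr0 mul0r add0r.
have [I1 I2 I3] := Iclosed_points ha.
have L0 : L%:C != 0 by rewrite fmorph_eq0 gt_eqF// divr_gt0// pi_gt0.
have B0 : B = 0.
  have /eqP := etrans bc1 bc2; rewrite !AB// -subr_eq0 rmorphN /=.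
  rewrite (_ : _ - _ = - (2 * L%:C * B)); last by ring.
  by rewrite oppr_eq0 !mulf_eq0 pnatr_eq0 (negPf L0)/= => /eqP.
have A0 : A = 0.
  have /eqP := bc2; rewrite !AB// B0 -subr_eq0 rmorphM /=.
  rewrite (_ : _ - _ = A * L%:C ^+ 2 * (1 - a%:C) * (1 + a%:C) / 2); last by ring.
  rewrite !mulf_eq0 (negPf L0) invr_eq0 pnatr_eq0 !orbF/=.
  move: ha => /andP[a1 a2].
  rewrite -(rmorph1 (real_complex R)) -rmorphB -rmorphD !fmorph_eq0.
  have -> : (1 - a == 0) = false by apply/negbTE; rewrite gt_eqF// subr_gt0.
  have -> : (1 + a == 0) = false by apply/negbTE; rewrite gt_eqF//; lra.
  by rewrite !orbF => /eqP.
apply: L2_ext; apply: filterS2 HA L2_zeroE => x h1 h2 Ix.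
by rewrite (h2 Ix) [LHS](h1 Ix) A0.
Qed.

Hypothesis na : ~ rational a.

Let e k := cexpi k L.
Let em k := cexpi (- k) L.
Let g k := cexpi k (L * a).
Let gm k := cexpi (- k) (L * a).

Lemma boundary_expsumE k P Q : boundary (expsum k P Q) <->
  P * em k + Q * e k = P * g k + Q * gm k /\ P * g k + Q * gm k = P * e k + Q * em k.
Proof. by rewrite /boundary /expsum !cexpiN opprK. Qed.

(** Irrationality of [a] enters here, excluding the exceptional case of the boundary algebra. *)
Lemma nonresonant k : k != 0 -> e k ^+ 2 = 1 -> g k <> e k.
Proof. by move=> k0 e1 ge; apply: na; exact: (cexpi_rational k0 e1 ge). Qed.

(** Both the source (H - k^2) u and [u] satisfy the boundary conditions; these two systems are the
    hypotheses of [boundary_resonance], which annihilates the source. *)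
Lemma ker2_exp k u : k != 0 -> op_dom H u ->
  op_ker (op_shift H (k ^+ 2)) (op_shift H (k ^+ 2) u) ->
  op_shift H (k ^+ 2) u = 0.
Proof.
move=> k0 du /(ker_expsum k0) [P [Q [HPQ /boundary_expsumE [b1 b2]]]].
have [y [z [cy cz uy ode bc]]] := Hop_regular ha du (expsum_continuous k P Q) HPQ.
have [P' [Q' PQ']] := ode_exp_inhomogeneous k0 cy cz ode.
have /boundary_on_closed := PQ' => /(_ bc) [].
rewrite !cexpiN opprK => c1 c2.
have [a1 a2] := andP ha.
have [|||||P0 Q0] := @boundary_resonance _ (e k) (em k) (g k) (gm k) P Q
  (cexpiNM _ _) (cexpiNM _ _) b1 b2 P' Q' (L%:C * (2 * 'i%C * k)^-1) a%:C (nonresonant k0).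
- rewrite mulf_neq0// ?invr_eq0 ?mulf_neq0 ?pnatr_eq0// ?fmorph_eq0.
    by rewrite gt_eqF// divr_gt0// pi_gt0.
  by rewrite eq_complex /= oner_eq0 andbF.
- by rewrite -(rmorph1 (real_complex R)) (inj_eq (fmorph_inj _)) lt_eqF.
- by rewrite -(rmorphN1 (real_complex R)) (inj_eq (fmorph_inj _)) gt_eqF.
- apply: etrans (etrans c1 _); first by rewrite /e /em rmorphN; ring.
  by rewrite /g /gm (rmorphM _ L a); ring.
- apply: etrans (etrans c2 _); first by rewrite /g /gm (rmorphM _ L a); ring.
  by rewrite /e /em; ring.
apply: L2_ext; apply: filterS2 HPQ L2_zeroE => x h1 h2 Ix.
by rewrite (h2 Ix) [LHS](h1 Ix) /expsum P0 Q0 !mul0r addr0.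
Qed.

Lemma alg_simple_exp k : k != 0 -> op_eigenvalue H (k ^+ 2) -> alg_simple H (k ^+ 2).
Proof.
move=> k0 [u0 [u0n ku0]]; apply: (alg_simple_ker_line u0n); last first.
  by move=> u; exact: ker2_exp.
have [P0 [Q0 [u0E bc0]]] := ker_expsum k0 ku0.
have [b1 b2] := (boundary_expsumE _ _ _).1 bc0.
have r0 := boundary_ratio (cexpiNM _ _) (cexpiNM _ _) b1 b2 (nonresonant k0).
move=> u; split=> [/(ker_expsum k0) [P [Q [uE bc]]]|[c ->]].
  have [d1 d2] := (boundary_expsumE _ _ _).1 bc.
  have r := boundary_ratio (cexpiNM _ _) (cexpiNM _ _) d1 d2 (nonresonant k0).
  have Q00 : Q0 != 0.
    apply: contraNneq u0n => Q00; apply/eqP; apply: L2_ext.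
    apply: filterS2 u0E L2_zeroE => x h1 h2 Ix.
    by rewrite (h2 Ix) (h1 Ix) /expsum r0 Q00 !mul0r addr0.
  (* The ratio of P to Q given by [boundary_ratio] depends on [k] alone, so comparing the
     coefficients Q is enough. *)
  exists (Q / Q0); apply: L2_ext.
  apply: filterS2 (filterI u0E uE) (L2_scaleE (Q / Q0) u0) => x [h1 h2] h3 Ix.
  rewrite (h3 Ix) (h2 Ix) (h1 Ix) /expsum r r0.
  by rewrite mulrDr !mulrA !divfK.
apply: (@expsum_ker _ (c * P0) (c * Q0)).
  apply: filterS2 (L2_scaleE c u0) u0E => x h1 h2 Ix.
  by rewrite (h1 Ix) (h2 Ix) /expsum mulrDr !mulrA.
apply/boundary_expsumE; split.
  by rewrite -!mulrA -!mulrDr b1.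
by rewrite -!mulrA -!mulrDr b2.
Qed.

Lemma alg_simple_zero : op_eigenvalue H 0 -> alg_simple H 0.
Proof.
move=> [u0 [u0n ku0]]; apply: (alg_simple_ker_line u0n); last exact: ker2_cst.
have [A0 u0E] := (ker_cst _).1 ku0.
have A00 : A0 != 0.
  apply: contraNneq u0n => A00; apply/eqP; apply: L2_ext.
  by apply: filterS2 u0E L2_zeroE => x h1 h2 Ix; rewrite (h2 Ix) (h1 Ix).
move=> u; split=> [/ker_cst [A uE]|[c ->]].
  exists (A / A0); apply: L2_ext.
  apply: filterS2 (filterI u0E uE) (L2_scaleE (A / A0) u0) => x [h1 h2] h3 Ix.
  by rewrite (h3 Ix) (h2 Ix) (h1 Ix) divfK.
apply/ker_cst; exists (c * A0).
by apply: filterS2 (L2_scaleE c u0) u0E => x h1 h2 Ix; rewrite (h1 Ix) (h2 Ix).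
Qed.

End Spectrum.

(** * A double eigenvalue for rational interior points *)

Section RationalCase.
Context {R : realType}.
Local Notation I := (Iopen R).
Local Notation L := (pi / 2 : R).
Local Notation "x %:C" := (x%:C)%C.
Implicit Types (u : L2 R) (P Q : R[i]).

Lemma cexpi_eq1 (k : R[i]) (x : R) (n : int) : complex.Im k = 0 ->
  complex.Re k * x = n%:~R * (pi *+ 2) -> cexpi k x = 1.
Proof.
rewrite /cexpi => -> ->; rewrite oppr0 mul0r expR0 !mul1r.
case: n => m.
  rewrite -[(Posz m)%:~R]/(m%:R : R) mulr_natl -[_ *+ m]add0r.
  by rewrite (periodicn (@cosD2pi R)) (periodicn (@sinD2pi R)) cos0 sin0.
rewrite NegzE mulrNz mulNr cosN sinN mulr_natl -[_ *+ m.+1]add0r.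
by rewrite (periodicn (@cosD2pi R)) (periodicn (@sinD2pi R)) cos0 sin0 oppr0.
Qed.

(** Evaluation at 0 gives P + Q = 0. At L / r, which lies in the closed interval since r >= 1, the
    exponentials are i and -i, so P - Q = 0. *)
Lemma expsum_ae0 (r : R) P Q : 1 <= r -> ae_equal (0 : L2 R) (expsum r%:C P Q) ->
  P = 0 /\ Q = 0.
Proof.
move=> r1 h; have r0 : 0 < r by exact: lt_le_trans r1.
have L0 : 0 < L by rewrite divr_gt0// pi_gt0.
have z : ae_equal (fun=> 0) (expsum r%:C P Q).
  by apply: filterS2 h L2_zeroE => x h1 h2 Ix; rewrite -(h2 Ix); exact: h1 Ix.
have {z h} z := ae_equal_closed (ccontinuousW (ccontinuous_cst 0))
  (ccontinuousW (expsum_continuous _ _ _)) z.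
have z0 : P + Q = 0.
  have I0 : Iclosed R 0 by rewrite /Iclosed/= in_itv/=; apply/andP; split; lra.
  by have := z 0 I0; rewrite /expsum !(@cexpi_eq1 _ _ 0) ?mulr1 ?mulr0 ?mul0r //= oppr0.
have z1 : 'i%C * (P - Q) = 0.
  have I1 : Iclosed R (L / r).
    rewrite /Iclosed/= in_itv/= ler_pdivrMr// ler_pdivlMr//.
    by apply/andP; split; nra.
  have rL : r * (L / r) = L by rewrite mulrC divfK// gt_eqF.
  have E1 : cexpi r%:C (L / r) = 'i%C.
    by rewrite /cexpi /= oppr0 mul0r expR0 !mul1r rL cos_pihalf sin_pihalf.
  have E2 : cexpi (- r%:C) (L / r) = - 'i%C.
    by rewrite -cexpiN /cexpi /= oppr0 mul0r expR0 !mul1r mulrN rL cosN sinN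
      cos_pihalf sin_pihalf /GRing.opp /= oppr0.
  by have := z _ I1; rewrite /expsum E1 E2 => ->; ring.
have PQ : P - Q = 0.
  by move/eqP: z1; rewrite mulf_eq0 eq_complex /= oner_eq0 andbF => /eqP.
have P0 : P = 0.
  transitivity ((P + Q + (P - Q)) / 2); first by field.
  by rewrite z0 PQ addr0 mul0r.
by move: z0; rewrite P0 add0r.
Qed.

Lemma rational_not_simple (a : R) : -1 < a < 1 -> rational a ->
  exists2 lambda : R[i], op_eigenvalue (Hop a) lambda & ~ alg_simple (Hop a) lambda.
Proof.
move=> ha /rationalP ra.
have {ra} [n [d [d0 aE]]] : exists (n : int) (d : nat), (0 < d)%N /\ a = n%:~R / d%:R.
  (* A zero denominator stands for the value 0, as division by zero returns 0; it is replaced by 0 /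
     1. *)
  case: ra => n [[|d] ->]; last by exists n, d.+1.
  by exists 0, 1%N; rewrite invr0 mulr0 mul0r.
(* With this choice kL = 2 pi d and kLa = 2 pi n are whole multiples of 2 pi. *)
pose r : R := 4 * d%:R; pose k : R[i] := r%:C.
have dR : d%:R != 0 :> R by rewrite pnatr_eq0 -lt0n.
have r1 : 1 <= r by rewrite /r -natrM ler1n muln_gt0.
have bc P Q : boundary a (expsum k P Q).
  have e1 : cexpi k L = 1.
    by apply: (@cexpi_eq1 _ _ d) => //=; rewrite -pmulrn mulr2n /r; field.
  have e2 : cexpi (- k) L = 1.
    by have := cexpiNM k L; rewrite e1 mul1r.
  have g1 : cexpi k (L * a) = 1.
    apply: (@cexpi_eq1 _ _ n) => //=; rewrite aE mulr2n /r; field.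
    by rewrite dR.
  have g2 : cexpi (- k) (L * a) = 1.
    by have := cexpiNM k (L * a); rewrite g1 mul1r.
  by rewrite /boundary /expsum !cexpiN opprK e1 e2 g1 g2 addrC.
have [u1 u1E] := L2_of_continuous (expsum_continuous k 1 0).
have [u2 u2E] := L2_of_continuous (expsum_continuous k 0 1).
have k1 := expsum_ker u1E (bc _ _); have k2 := expsum_ker u2E (bc _ _).
have u1n : u1 != 0.
  apply/eqP => u10; have [] := @expsum_ae0 r 1 0 r1; first by rewrite -u10.
  by move=> /eqP; rewrite oner_eq0.
exists (k ^+ 2); first by exists u1.
case=> b [_ rootE].
have inroot u : op_ker (op_shift (Hop a) (k ^+ 2)) u -> exists c, u = c *: b ord0.
  move=> [du Hu].
  have : root_space (Hop a) (k ^+ 2) u by exists 1%N.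
  by rewrite rootE => -[c ->]; exists (c ord0); rewrite big_ord1.
have [c1 u1b] := inroot _ k1; have [c2 u2b] := inroot _ k2.
have c10 : c1 != 0 by apply: contraNneq u1n => c10; rewrite u1b c10 scale0r.
(* If u1 = c1 b and u2 = c2 b, then c2 u1 - c1 u2 = 0, against the independence of the two
   exponentials. *)
have : ae_equal (0 : L2 R) (expsum k c2 (- c1)).
  have -> : (0 : L2 R) = c2 *: u1 + (- c1) *: u2.
    by rewrite u1b u2b !scalerA -scalerDl mulNr mulrC subrr scale0r.
  have h := L2_addE (c2 *: u1) (- c1 *: u2).
  apply: filterS2 (filterI h (filterI (L2_scaleE c2 u1) (L2_scaleE (- c1) u2)))
    (filterI u1E u2E) => x [h1 [h2 h3]] [h4 h5] Ix.
  rewrite [LHS](h1 Ix) (h2 Ix) (h3 Ix) (h4 Ix) (h5 Ix) /expsum; ring.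
by move=> /(expsum_ae0 r1) [_ /eqP]; rewrite oppr_eq0 (negPf c10).
Qed.

End RationalCase.

Theorem theorem1 (R : realType) (a : R) (ha : -1 < a < 1) :
  (forall lambda : R[i],
      op_eigenvalue (Hop a) lambda -> alg_simple (Hop a) lambda) <->
  ~ rational a.
Proof.
split=> [simple ra|na lambda].
  by have [lambda /simple ? ?] := rational_not_simple ha ra.
have [->|l0] := eqVneq lambda 0; first exact: alg_simple_zero.
(* Every nonzero complex eigenvalue is written k^2 with k its complex square root. *)
rewrite -(sqrtCK lambda); apply: alg_simple_exp => //.
by rewrite sqrtC_eq0.
Qed.
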